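(* (a) There exists a finite set $\mathcal{F}$ of pathographs such that the following problem is undecidable: given a pathograph $\mathfrak{H}$, is there an $\mathcal{F}$-free realization of $\mathfrak{H}$? (b) There exists a pathograph $\mathfrak{H}$ such that the following problem is undecidable: given a finite set $\mathcal{F}$ of pathographs, is there an $\mathcal{F}$-free realization of $\mathfrak{H}$?
   Context: All graphs are finite and simple. A pathograph is a tuple $\mathfrak{G}=(V,U,E,S,R,\pi)$ where $V$ (vertices) and $U$ (urpaths) are finite disjoint sets, $E\subseteq\binom{V}{2}$ (edges), $S\subseteq V\times U$ (spokes), $R\subseteq\binom{U}{2}$ (rungs), and $\pi:U\to\binom{V}{2}$ assigns to each urpath its two distinct endpoints, with $\pi(U)\cap E=\emptyset$. A realization of $\mathfrak{G}$ is a graph obtained as follows: start from the graph $(V,E)$; for each urpath $u$ with endpoints $a,b$ add new vertices $x_u^{(1)},\dots,x_u^{(m_u)}$ ($m_u\ge1$, the internal vertices of $u$) and the edges of the path $a x_u^{(1)}\cdots x_u^{(m_u)} b$; the only further edges added are: for each spoke $(v,u)$, a nonempty set of edges between $v$ and internal vertices of $u$; for each rung $\{u,u'\}$, a nonempty set of edges between internal vertices of $u$ and of $u'$. A graph $G$ contains a pathograph $\mathfrak{F}$ if some induced subgraph of $G$ is isomorphic to a realization of $\mathfrak{F}$; $G$ is $\mathcal{F}$-free if it contains no member of $\mathcal{F}$. *)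

(* Defs.v *)
From mathcomp Require Import all_boot.
Set Implicit Arguments. Unset Strict Implicit. Unset Printing Implicit Defensive.

Inductive recf : Type :=
| RZero : recf
| RSucc : recf
| RProj : nat -> recf
| RComp : recf -> seq recf -> recf
| RPrim : recf -> recf -> recf
| RMu   : recf -> recf.

Inductive reval : recf -> seq nat -> nat -> Prop :=
| ev_zero v : reval RZero v 0
| ev_succ x v : reval RSucc (x :: v) x.+1
| ev_proj i v : i < size v -> reval (RProj i) v (nth 0 v i)
| ev_comp f gs v ys y : revals gs v ys -> reval f ys y -> reval (RComp f gs) v y
| ev_prim0 f g v y : reval f v y -> reval (RPrim f g) (0 :: v) y
| ev_primS f g n v r y :
    reval (RPrim f g) (n :: v) r -> reval g (n :: r :: v) y ->
    reval (RPrim f g) (n.+1 :: v) y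
| ev_mu f v n :
    reval f (n :: v) 0 ->
    (forall m, m < n -> exists k, reval f (m :: v) k.+1) ->
    reval (RMu f) v n
with revals : seq recf -> seq nat -> seq nat -> Prop :=
| evs_nil v : revals [::] v [::]
| evs_cons g gs v y ys : reval g v y -> revals gs v ys -> revals (g :: gs) v (y :: ys).

Definition decidable_set (A : nat -> Prop) : Prop :=
  exists f : recf, forall n, (A n /\ reval f [:: n] 1) \/ (~ A n /\ reval f [:: n] 0).

Definition undecidable_set (A : nat -> Prop) : Prop := ~ decidable_set A.

(* V = {0,..,pg_nv-1}, U = {0,..,pg_nu-1} (two disjoint index sets);   *)
(* E, S, R given as lists of pairs; pi as the list of endpoint pairs.  *)
Record pathograph := Pathograph {
  pg_nv : nat;
  pg_nu : nat;
  pg_E  : seq (nat * nat);   (* unordered edges {a,b} *)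
  pg_S  : seq (nat * nat);   (* spokes (v,u) *)
  pg_R  : seq (nat * nat);   (* unordered rungs {u,u'} *)
  pg_pi : seq (nat * nat)    (* pi u = {(nth pi u).1, (nth pi u).2} *)
}.

Section PG.
Variable H : pathograph.

Definition pg_edge (a b : nat) : bool := ((a, b) \in pg_E H) || ((b, a) \in pg_E H).
Definition pg_spoke (v u : nat) : bool := (v, u) \in pg_S H.
Definition pg_rung (u u' : nat) : bool := ((u, u') \in pg_R H) || ((u', u) \in pg_R H).
Definition pg_end1 (u : nat) : nat := (nth (0, 0) (pg_pi H) u).1.
Definition pg_end2 (u : nat) : nat := (nth (0, 0) (pg_pi H) u).2.

Definition pg_wf : bool :=
  [&& all (fun p => [&& p.1 < pg_nv H, p.2 < pg_nv H & p.1 != p.2]) (pg_E H),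
      all (fun p => (p.1 < pg_nv H) && (p.2 < pg_nu H)) (pg_S H),
      all (fun p => [&& p.1 < pg_nu H, p.2 < pg_nu H & p.1 != p.2]) (pg_R H),
      size (pg_pi H) == pg_nu H,
      all (fun p => [&& p.1 < pg_nv H, p.2 < pg_nv H & p.1 != p.2]) (pg_pi H) &
      all (fun p => ~~ pg_edge p.1 p.2) (pg_pi H)].

(* [realizes_on adj X] : the subgraph of (T, adj) induced on X is (isomorphic to)
   a realization of H.  f : vertices of H -> T ; g u i : i-th internal vertex
   (0 <= i < m u) of urpath u; path is  end1 u, g u 0, ..., g u (m u - 1), end2 u. *)
Definition realizes_on (T : finType) (adj : rel T) (X : pred T) : Prop :=
  exists (f : nat -> T) (g : nat -> nat -> T) (m : nat -> nat)
         (sp : nat -> nat -> nat -> bool) (rg : nat -> nat -> nat -> nat -> bool),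
      (forall u, u < pg_nu H -> 0 < m u) /\
      (forall a, a < pg_nv H -> X (f a)) /\
      (forall u i, u < pg_nu H -> i < m u -> X (g u i)) /\
      (forall a b, a < pg_nv H -> b < pg_nv H -> f a = f b -> a = b) /\
      (forall u i u' j, u < pg_nu H -> i < m u -> u' < pg_nu H -> j < m u' ->
          g u i = g u' j -> u = u' /\ i = j) /\
      (forall a u i, a < pg_nv H -> u < pg_nu H -> i < m u -> f a <> g u i) /\
      (forall x, X x -> (exists2 a, a < pg_nv H & f a = x) \/
                        (exists u i, [/\ u < pg_nu H, i < m u & g u i = x])) /\
      (forall a b, a < pg_nv H -> b < pg_nv H -> adj (f a) (f b) = pg_edge a b) /\
      (forall a u i, a < pg_nv H -> u < pg_nu H -> i < m u ->
          adj (f a) (g u i) =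
            [|| (a == pg_end1 u) && (i == 0), (a == pg_end2 u) && (i == (m u).-1)
              | pg_spoke a u && sp a u i]) /\
      (forall a u, a < pg_nv H -> u < pg_nu H -> pg_spoke a u ->
          exists2 i, i < m u & sp a u i) /\
      (forall u i u' j, u < pg_nu H -> i < m u -> u' < pg_nu H -> j < m u' ->
          adj (g u i) (g u' j) =
            if u == u' then (i.+1 == j) || (j.+1 == i)
            else pg_rung u u' && rg u i u' j) /\
      (forall u u', u < pg_nu H -> u' < pg_nu H -> u != u' -> pg_rung u u' ->
          exists i j, [/\ i < m u, j < m u' & rg u i u' j]).

End PG.

Definition simple_graph (n : nat) (adj : rel 'I_n) : Prop :=
  symmetric adj /\ irreflexive adj.

Definition contains_pg (n : nat) (adj : rel 'I_n) (F : pathograph) : Prop :=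
  exists X : {set 'I_n}, realizes_on F adj (mem X).

Definition pg_empty : pathograph := Pathograph 0 0 [::] [::] [::] [::].

Definition has_free_realization (Fs : seq pathograph) (H : pathograph) : Prop :=
  exists (n : nat) (adj : rel 'I_n),
    [/\ simple_graph adj, realizes_on H adj predT &
        forall i, i < size Fs -> ~ contains_pg adj (nth pg_empty Fs i)].

Definition code_pairs (s : seq (nat * nat)) : nat :=
  CodeSeq.code (flatten [seq [:: p.1; p.2] | p <- s]).

Definition encode_pg (H : pathograph) : nat :=
  CodeSeq.code [:: pg_nv H; pg_nu H; code_pairs (pg_E H); code_pairs (pg_S H);
                   code_pairs (pg_R H); code_pairs (pg_pi H)].

Definition encode_pgs (Fs : seq pathograph) : nat := CodeSeq.code (map encode_pg Fs).

(* Main.v *)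
Require Import Defs.
From HB Require Import structures.
From mathcomp Require Import all_boot zify boolp.
Set Implicit Arguments. Unset Strict Implicit. Unset Printing Implicit Defensive.

(** Recursive functions are compiled to counter machines, and counter machines are
    interpreted by a total recursive function; a machine searching for a halting time
    of its input program has an undecidable halting problem by diagonalization.

    A run of such a machine is drawn as a graph: one path of time steps, one path for
    each register, one path of program counters and one input path, all joining the
    same two vertices, where a time step is adjacent to the position of each register
    value and of the current program counter.  Further vertices of a rigid frame colour
    each path cyclically, so that an induced subgraph on a few vertices sees in which
    direction a path is traversed.  Then every rule of the machine reads "these five
    vertices do not look like that", and finitely many forbidden graphs, each containing
    the whole frame, force a realization to record a run that halts at the last time
    step.  Since urpaths have at least one internal vertex and spokes at least one edge,
    the initial configuration and each program counter do exist.

    For (a) the input path consists of ordinary vertices, one of which is marked.  For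
    (b) it is an urpath, and forbidding marked initial segments of length below n and
    one unmarked initial segment puts the mark at position n. *)

(** * Total recursive functions *)

(** Whatever else a time step sees, it also sees the true configuration, so a realization need not
    encode a deterministic run for the simulation to go through.

    The lengths of urpaths are not prescribed, and a bounded pattern cannot count. Positions on two
    paths are therefore compared by edges that are forced inductively along both, and a rule keeps
    the register vertices in use away from the end of their path, so that an increment always finds
    its target.

    The number [M] of colours plays two roles. It is at least 3, so that the two neighbours of an
    inner path vertex differ in colour. It also exceeds every jump target, so that a colour on the
    path of program counters can name a program counter; register values are unbounded and are
    encoded by positions instead.

    The list of forbidden patterns need not be computed: it is fixed once the machine is, hence it
    may be selected classically. *)

Definition total_rec (k : nat) (F : seq nat -> nat) : Prop :=
  exists f, forall v, size v = k -> reval f v (F v).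

Lemma total_rec_ext k F G :
  (forall v, size v = k -> F v = G v) -> total_rec k F -> total_rec k G.
Proof. by move=> FG [f Hf]; exists f => v sv; rewrite -FG //; apply: Hf. Qed.

Lemma total_recs k (Fs : seq (seq nat -> nat)) :
  (forall i, i < size Fs -> total_rec k (nth (fun=> 0) Fs i)) ->
  exists fs, forall v, size v = k -> revals fs v [seq F v | F <- Fs].
Proof.
elim: Fs => [|F Fs IH] H; first by exists [::] => v _; apply: evs_nil.
have [f Hf] := H 0 isT; have [fs Hfs] := IH (fun i => H i.+1).
by exists (f :: fs) => v sv; apply: evs_cons; [apply: Hf|apply: Hfs].
Qed.

Lemma total_rec_comp k G (Fs : seq (seq nat -> nat)) :
  total_rec (size Fs) G ->
  (forall i, i < size Fs -> total_rec k (nth (fun=> 0) Fs i)) ->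
  total_rec k (fun v => G [seq F v | F <- Fs]).
Proof.
move=> [g Hg] /total_recs[fs Hfs]; exists (RComp g fs) => v sv.
by apply: ev_comp (Hfs v sv) _; apply: Hg; rewrite size_map.
Qed.

Lemma total_rec_var k i : i < k -> total_rec k (fun v => nth 0 v i).
Proof. by move=> ik; exists (RProj i) => v sv; apply: ev_proj; rewrite sv. Qed.

Lemma total_rec_subst k n G (F : nat -> seq nat -> nat) :
  total_rec n G -> (forall i, i < n -> total_rec k (F i)) ->
  total_rec k (fun v => G [seq F i v | i <- iota 0 n]).
Proof.
move=> HG HF; pose Fs := [seq F i | i <- iota 0 n].
have sFs : size Fs = n by rewrite size_map size_iota.
apply: (@total_rec_ext _ (fun v => G [seq F v | F <- Fs])) => [v _|].
  by rewrite -map_comp.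
apply: total_rec_comp => [|i]; rewrite sFs // => il.
by rewrite (nth_map 0) ?size_iota // nth_iota //; apply: HF.
Qed.

Lemma total_rec_app1 k (g : nat -> nat) F :
  total_rec 1 (fun v => g (nth 0 v 0)) -> total_rec k F ->
  total_rec k (fun v => g (F v)).
Proof. by move=> Hg HF; apply: (total_rec_comp (Fs := [:: F]) Hg) => -[|]. Qed.

Lemma total_rec_succ k F : total_rec k F -> total_rec k (fun v => (F v).+1).
Proof.
apply: (total_rec_app1 (g := S)).
by exists RSucc => -[|x []] // _; apply: ev_succ.
Qed.

Lemma total_rec_const k c : total_rec k (fun=> c).
Proof.
elim: c => [|c]; first by exists RZero => v _; apply: ev_zero.
exact: total_rec_succ.
Qed.

Lemma seq_iota_nth (v : seq nat) k :
  size v = k -> [seq nth 0 v i | i <- iota 0 k] = v.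
Proof. by move=> <-; apply: mkseq_nth. Qed.

Lemma total_rec_behead k F :
  total_rec k F -> total_rec k.+1 (fun w => F (behead w)).
Proof.
move=> HF; pose P i v := nth 0 v i.+1.
apply: (@total_rec_ext _ (fun v => F [seq P i v | i <- iota 0 k])) => [v sv|].
  congr F; rewrite -[RHS](@seq_iota_nth _ k) ?size_behead ?sv //.
  by apply: eq_map => i; rewrite nth_behead.
by apply: total_rec_subst => // i ik; apply: total_rec_var.
Qed.

(** [iteri] has the shape of [RPrim]: the step sees the counter, the previous value and the
    parameters, in this order. *)
Lemma total_rec_iteri k N A (G : nat -> nat -> seq nat -> nat) :
  total_rec k N -> total_rec k A ->
  total_rec k.+2 (fun w => G (nth 0 w 0) (nth 0 w 1) (behead (behead w))) ->
  total_rec k (fun v => iteri (N v) (fun i r => G i r v) (A v)).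
Proof.
move=> [n Hn] [a Ha] [g Hg].
exists (RComp (RPrim a g) (n :: [seq RProj i | i <- iota 0 k])) => v sv.
apply: (@ev_comp _ _ _ (N v :: v)).
  apply: evs_cons; first exact: Hn.
  rewrite -{2}(seq_iota_nth sv).
  have : {in iota 0 k, forall i, i < size v} by move=> i; rewrite mem_iota sv.
  elim: (iota 0 k) => [|i s IH] H /=; first exact: evs_nil.
  apply: evs_cons; first by apply: ev_proj; apply: H; rewrite mem_head.
  by apply: IH => j js; apply: H; rewrite inE js orbT.
elim: (N v) => [|m IH] /=; first by apply: ev_prim0; apply: Ha.
by apply: ev_primS IH _; apply: (Hg [:: _, _ & v]); rewrite /= sv.
Qed.

Lemma total_rec_add k F G :
  total_rec k F -> total_rec k G -> total_rec k (fun v => F v + G v).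
Proof.
move=> HF HG.
apply: (@total_rec_ext _ (fun v => iteri (F v) (fun _ r => r.+1) (G v))) => [v _|].
  by elim: (F v) => //= n ->.
apply: (total_rec_iteri (G := fun _ r _ => r.+1)) => //.
by apply: total_rec_succ; apply: total_rec_var.
Qed.

Lemma total_rec_mul k F G :
  total_rec k F -> total_rec k G -> total_rec k (fun v => F v * G v).
Proof.
move=> HF HG.
apply: (@total_rec_ext _ (fun v => iteri (F v) (fun _ r => G v + r) 0)) => [v _|].
  by elim: (F v) => //= n ->; rewrite mulSn.
apply: (total_rec_iteri (G := fun _ r v => G v + r)) => //; first exact: total_rec_const.
apply: total_rec_add; last exact: total_rec_var.
exact: (total_rec_behead (total_rec_behead HG)).
Qed.

Lemma total_rec_exp k F G :
  total_rec k F -> total_rec k G -> total_rec k (fun v => F v ^ G v).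
Proof.
move=> HF HG.
apply: (@total_rec_ext _ (fun v => iteri (G v) (fun _ r => F v * r) 1)) => [v _|].
  by elim: (G v) => //= n ->; rewrite expnS.
apply: (total_rec_iteri (G := fun _ r v => F v * r)) => //; first exact: total_rec_const.
apply: total_rec_mul; last exact: total_rec_var.
exact: (total_rec_behead (total_rec_behead HF)).
Qed.

Lemma total_rec_pred k F : total_rec k F -> total_rec k (fun v => (F v).-1).
Proof.
move=> HF.
apply: (@total_rec_ext _ (fun v => iteri (F v) (fun i _ => i) 0)) => [v _|].
  by case: (F v).
apply: (total_rec_iteri (G := fun i _ _ => i)) => //; first exact: total_rec_const.
exact: total_rec_var.
Qed.

Lemma total_rec_sub k F G :
  total_rec k F -> total_rec k G -> total_rec k (fun v => F v - G v).
Proof.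
move=> HF HG.
apply: (@total_rec_ext _ (fun v => iteri (G v) (fun _ r => r.-1) (F v))) => [v _|].
  by elim: (G v) => [|n /= ->]; rewrite ?subn0 // subnS.
apply: (total_rec_iteri (G := fun _ r _ => r.-1)) => //.
by apply: total_rec_pred; apply: total_rec_var.
Qed.

Lemma total_rec_leq k F G :
  total_rec k F -> total_rec k G -> total_rec k (fun v => F v <= G v : nat).
Proof.
move=> HF HG.
apply: (@total_rec_ext _ (fun v => 1 - (F v - G v))) => [v _|].
  by rewrite /leq; case: (F v - G v).
by apply: total_rec_sub; [apply: total_rec_const|apply: total_rec_sub].
Qed.

Lemma total_rec_if k (B : seq nat -> bool) F G :
  total_rec k (fun v => B v : nat) -> total_rec k F -> total_rec k G ->
  total_rec k (fun v => if B v then F v else G v).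
Proof.
move=> HB HF HG.
apply: (@total_rec_ext _ (fun v => B v * F v + (1 - B v) * G v)) => [v _|].
  by case: (B v); rewrite ?mul1n ?mul0n ?addn0.
apply: total_rec_add; apply: total_rec_mul => //.
by apply: total_rec_sub => //; apply: total_rec_const.
Qed.

Lemma total_rec_sum k N (F : nat -> seq nat -> nat) :
  total_rec k N -> total_rec k.+1 (fun w => F (nth 0 w 0) (behead w)) ->
  total_rec k (fun v => \sum_(i < N v) F i v).
Proof.
move=> HN HF.
apply: (@total_rec_ext _ (fun v => iteri (N v) (fun i r => r + F i v) 0)) => [v _|].
  by elim: (N v) => [|n /= ->]; rewrite ?big_ord0 ?big_ord_recr.
apply: (total_rec_iteri (G := fun i r v => r + F i v)) => //.
  exact: total_rec_const.
apply: total_rec_add; first exact: total_rec_var.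
(* The summand reads the counter and the parameters; index 1, the accumulator, is skipped. *)
pose P i (w : seq nat) := nth 0 w (if i is j.+1 then j.+2 else 0).
pose F' w := F (nth 0 w 0) (behead w).
apply: (@total_rec_ext _ (fun w => F' [seq P i w | i <- iota 0 k.+1])).
  move=> [|a [|b w]] //= [sw]; rewrite /F' /=; congr F.
  rewrite -[RHS](seq_iota_nth sw) -(addn0 1) iotaDl -map_comp.
  by apply: eq_map => i.
by apply: total_rec_subst => // -[|i] ik; apply: total_rec_var; lia.
Qed.

(** The quotient counts the positive multiples of [d] up to [m]; as a bounded sum it needs no
    search. *)
Lemma divn_sum m d : d > 0 -> m %/ d = \sum_(i < m) ((i.+1 * d <= m) : nat).
Proof.
move=> d0; rewrite (eq_bigr (fun i : 'I_m => (i < m %/ d) : nat)); last first.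
  by move=> i _; rewrite leq_divRL.
rewrite -(big_mkord xpredT (fun i => (i < m %/ d) : nat)).
rewrite (big_cat_nat (n := m %/ d)) //= ?leq_div //.
rewrite big_nat (eq_bigr (fun=> 1)) => [|i /andP[_ ->]] //.
rewrite -big_nat sum_nat_const_nat subn0 muln1.
by rewrite big_nat big1 ?addn0 // => i /andP[]; case: ltnP => //; lia.
Qed.

Lemma total_rec_div k F G :
  (forall v, 0 < G v) ->
  total_rec k F -> total_rec k G -> total_rec k (fun v => F v %/ G v).
Proof.
move=> G0 HF HG.
apply: (@total_rec_ext _ (fun v => \sum_(i < F v) ((i.+1 * G v <= F v) : nat))).
  by move=> v _; rewrite divn_sum.
apply: (total_rec_sum (F := fun i v => (i.+1 * G v <= F v) : nat)) => //.
apply: total_rec_leq; last exact: total_rec_behead.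
apply: total_rec_mul; last exact: total_rec_behead.
by apply: total_rec_succ; apply: total_rec_var.
Qed.

Lemma total_rec_mod k F G :
  (forall v, 0 < G v) ->
  total_rec k F -> total_rec k G -> total_rec k (fun v => F v %% G v).
Proof.
move=> G0 HF HG.
apply: (@total_rec_ext _ (fun v => F v - F v %/ G v * G v)) => [v _|].
  by rewrite {1}(divn_eq (F v) (G v)) addKn.
by apply: total_rec_sub => //; apply: total_rec_mul => //; apply: total_rec_div.
Qed.

Lemma total_rec_eq0 k F : total_rec k F -> total_rec k (fun v => (F v == 0) : nat).
Proof.
move=> HF; apply: (@total_rec_ext _ (fun v => 1 - F v)) => [v _|]; first by case: (F v).
by apply: total_rec_sub => //; apply: total_rec_const.
Qed.

(* [CodeSeq.code (x :: s) = code_cons x (CodeSeq.code s)]. *)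
Definition code_cons (x c : nat) : nat := 2 ^ x * c.*2.+1.

(** The 2-adic valuation, which lies below [c] for positive [c], as a bounded sum. At 0, the code of
    the empty list, the sum is empty, so that reading beyond the end of a list gives 0. *)
Definition code_head (c : nat) : nat := \sum_(i < c) ((c %% 2 ^ i.+1 == 0) : nat).
Definition code_tail (c : nat) : nat := (c %/ 2 ^ code_head c) %/ 2.

Lemma logn_code_cons x c : logn 2 (code_cons x c) = x.
Proof.
rewrite /code_cons lognM ?expn_gt0 // pfactorK // lognE.
by rewrite /= dvdn2 /= odd_double addn0.
Qed.

Lemma code_cons_gt0 x c : 0 < code_cons x c.
Proof. by rewrite /code_cons muln_gt0 expn_gt0. Qed.

Lemma code_head_cons x c : code_head (code_cons x c) = x.
Proof.
rewrite /code_head; set m := code_cons x c.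
have m0 : 0 < m by apply: code_cons_gt0.
have xm : x < m.
  apply: leq_trans (ltn_expl x (ltnSn 1)) _.
  by rewrite /m /code_cons leq_pmulr.
rewrite (eq_bigr (fun i : 'I_m => (i < x) : nat)); last first.
  move=> i _; congr nat_of_bool.
  by rewrite -[_ == 0]/(2 ^ i.+1 %| m) pfactor_dvdn // logn_code_cons.
rewrite -(big_mkord xpredT (fun i => (i < x) : nat)).
rewrite (big_cat_nat (n := x)) //= ?(ltnW xm) //.
rewrite big_nat (eq_bigr (fun=> 1)) => [|i /andP[_ ->]] //.
rewrite -big_nat sum_nat_const_nat subn0 muln1.
by rewrite big_nat big1 ?addn0 // => i /andP[]; case: ltnP => //; lia.
Qed.

Lemma code_tail_cons x c : code_tail (code_cons x c) = c.
Proof.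
rewrite /code_tail code_head_cons /code_cons mulKn ?expn_gt0 //.
by rewrite divn2 /= uphalf_double.
Qed.

Lemma code_tail0 : code_tail 0 = 0. Proof. by rewrite /code_tail div0n. Qed.
Lemma code_head0 : code_head 0 = 0. Proof. by rewrite /code_head big_ord0. Qed.

Lemma total_rec_cons k F G :
  total_rec k F -> total_rec k G -> total_rec k (fun v => code_cons (F v) (G v)).
Proof.
move=> HF HG.
apply: (@total_rec_ext _ (fun v => 2 ^ F v * (G v * 2).+1)) => [v _|].
  by rewrite /code_cons muln2.
apply: total_rec_mul; first by apply: total_rec_exp => //; apply: total_rec_const.
by apply: total_rec_succ; apply: total_rec_mul => //; apply: total_rec_const.
Qed.

Lemma total_rec_head k F : total_rec k F -> total_rec k (fun v => code_head (F v)).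
Proof.
apply: total_rec_app1.
apply: (total_rec_sum (F := fun i v => (nth 0 v 0 %% 2 ^ i.+1 == 0) : nat)).
  exact: total_rec_var.
apply: total_rec_eq0; apply: total_rec_mod => [v||]; first by rewrite expn_gt0.
  exact: total_rec_behead (total_rec_var _).
apply: total_rec_exp; first exact: total_rec_const.
by apply: total_rec_succ; apply: total_rec_var.
Qed.

Lemma total_rec_tail k F : total_rec k F -> total_rec k (fun v => code_tail (F v)).
Proof.
move=> HF; apply: total_rec_div => //; last exact: total_rec_const.
apply: total_rec_div => // [v|]; first by rewrite expn_gt0.
by apply: total_rec_exp; [apply: total_rec_const|apply: total_rec_head].
Qed.

Definition code_nth (c i : nat) : nat := code_head (iter i code_tail c).

Lemma code_nthP s i : code_nth (CodeSeq.code s) i = nth 0 s i.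
Proof.
elim: s i => [|x s IH] i.
  rewrite nth_nil /code_nth /=; elim: i => [|i IH] /=; first exact: code_head0.
  suff -> : iter i code_tail 0 = 0 by rewrite code_tail0 code_head0.
  by elim: i {IH} => //= i ->; apply: code_tail0.
rewrite -[CodeSeq.code _]/(code_cons x (CodeSeq.code s)) /code_nth.
by case: i => [|i]; rewrite ?iterSr ?code_tail_cons /= ?code_head_cons // -IH.
Qed.

Lemma total_rec_nth k F G :
  total_rec k F -> total_rec k G -> total_rec k (fun v => code_nth (F v) (G v)).
Proof.
move=> HF HG; apply: total_rec_head.
apply: (@total_rec_ext _ (fun v => iteri (G v) (fun _ r => code_tail r) (F v))).
  by move=> v _; elim: (G v) => //= n ->.
apply: (total_rec_iteri (G := fun _ r _ => code_tail r)) => //.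
by apply: total_rec_tail; apply: total_rec_var.
Qed.

(** * Counter machines *)

Definition regs := nat -> nat.
Definition upd (s : regs) (r x : nat) : regs := fun q => if q == r then x else s q.

Lemma upd_same s r x : upd s r x r = x. Proof. by rewrite /upd eqxx. Qed.
Lemma upd_other s r x q : q != r -> upd s r x q = s q.
Proof. by rewrite /upd => /negPf ->. Qed.

Inductive instr : Type :=
| INC : nat -> nat -> instr
| DEC : nat -> nat -> nat -> instr.

Definition cm_step (P : seq instr) (x : nat * regs) : nat * regs :=
  if x.1 < size P then
    match nth (INC 0 0) P x.1 with
    | INC r j => (j, upd x.2 r (x.2 r).+1)
    | DEC r j k => if x.2 r is y.+1 then (j, upd x.2 r y) else (k, x.2)
    end
  else x.

Definition cm_run (P : seq instr) (t : nat) (x : nat * regs) := iter t (cm_step P) x.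
Definition cm_init (n : nat) : nat * regs := (0, upd (fun=> 0) 0 n).
Definition cm_halts (P : seq instr) (n : nat) : Prop :=
  exists t, size P <= (cm_run P t (cm_init n)).1.

Lemma cm_run_add P t u x : cm_run P (t + u) x = cm_run P u (cm_run P t x).
Proof. by rewrite /cm_run addnC iterD. Qed.

Lemma cm_run_halted P t x : size P <= x.1 -> cm_run P t x = x.
Proof.
move=> h; elim: t => //= t ->; rewrite /cm_step ltnNge h //.
Qed.

(** * Structured programs and their translation into counter machines *)

Inductive cmd : Type :=
| Inc : nat -> cmd
| Clr : nat -> cmd
| Seq : cmd -> cmd -> cmd
| Loop : nat -> cmd -> cmd.

(* [Loop r c] is "while r is nonzero, decrement r and run c". *)
Inductive exec : cmd -> regs -> regs -> Prop :=
| ex_inc r s : exec (Inc r) s (upd s r (s r).+1)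
| ex_clr r s : exec (Clr r) s (upd s r 0)
| ex_seq c1 c2 s s' s'' : exec c1 s s' -> exec c2 s' s'' -> exec (Seq c1 c2) s s''
| ex_loop0 r c s : s r = 0 -> exec (Loop r c) s s
| ex_loopS r c s s' s'' y : s r = y.+1 -> exec c (upd s r y) s' ->
    exec (Loop r c) s' s'' -> exec (Loop r c) s s''.

Fixpoint clen (c : cmd) : nat :=
  match c with
  | Inc _ | Clr _ => 1
  | Seq c1 c2 => clen c1 + clen c2
  | Loop _ c => (clen c).+1
  end.

(* Code of [c] loaded at address [a] and leaving to address [e]. *)
Fixpoint flat (c : cmd) (a e : nat) : seq instr :=
  match c with
  | Inc r => [:: INC r e]
  | Clr r => [:: DEC r a e]
  | Seq c1 c2 => flat c1 a (a + clen c1) ++ flat c2 (a + clen c1) e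
  | Loop r c => DEC r a.+1 e :: flat c a.+1 a
  end.

Lemma size_flat c a e : size (flat c a e) = clen c.
Proof. by elim: c a e => //= [c1 IH1 c2 IH2|_ c IH] a e; rewrite ?size_cat ?IH1 ?IH2 ?IH. Qed.

Definition code_at (P : seq instr) (a : nat) (l : seq instr) : Prop :=
  forall i, i < size l -> a + i < size P /\ nth (INC 0 0) P (a + i) = nth (INC 0 0) l i.

Lemma code_at_catl P a l1 l2 : code_at P a (l1 ++ l2) -> code_at P a l1.
Proof.
move=> H i il; have [|h ->] := H i; first by rewrite size_cat ltn_addr.
by rewrite nth_cat il.
Qed.

Lemma code_at_catr P a l1 l2 : code_at P a (l1 ++ l2) -> code_at P (a + size l1) l2.
Proof.
move=> H i il; have := H (size l1 + i); rewrite size_cat ltn_add2l addnA => -[//|h ->].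
by rewrite nth_cat [_ < size l1]ltnNge leq_addr /= addKn.
Qed.

Definition reach (P : seq instr) (x y : nat * regs) : Prop := exists t, cm_run P t x = y.

Lemma reach_trans P x y z : reach P x y -> reach P y z -> reach P x z.
Proof. by move=> [t <-] [u <-]; exists (t + u); rewrite cm_run_add. Qed.

Lemma reach_step P x y : cm_step P x = y -> reach P x y.
Proof. by exists 1. Qed.

Lemma upd_upd s r x y : upd (upd s r x) r y = upd s r y.
Proof. by apply: funext => q; rewrite /upd; case: eqP. Qed.

Lemma upd_id s r : upd s r (s r) = s.
Proof. by apply: funext => q; rewrite /upd; case: eqP => // ->. Qed.

Lemma loop_step P r c a e s y : code_at P a (flat (Loop r c) a e) -> s r = y.+1 ->
  cm_step P (a, s) = (a.+1, upd s r y).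
Proof.
by move=> H sr; have [] := H 0 isT; rewrite addn0 /cm_step /= => -> ->; rewrite sr.
Qed.

Lemma code_at_loop P r c a e : code_at P a (flat (Loop r c) a e) ->
  code_at P a.+1 (flat c a.+1 a).
Proof. by move=> /(@code_at_catr _ _ [:: _]); rewrite /= addn1. Qed.

Lemma flat_exec P c a e s s' :
  exec c s s' -> code_at P a (flat c a e) -> reach P (a, s) (e, s').
Proof.
move=> E; elim: E a e => {c s s'} [r s|r s|c1 c2 s s' s'' _ IH1 _ IH2|r c s sr|
  r c s s' s'' y sr _ IH1 _ IH2] a e H.
- by apply: reach_step; have [] := H 0 isT; rewrite addn0 /cm_step /= => -> ->.
(* A clear is a single instruction that jumps back to itself, so it needs its own induction on the
   value of the register. *)
- have [n] := ubnP (s r); elim: n s => // n IH s sn.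
  have [h1 h2] := H 0 isT; rewrite addn0 /= in h1 h2.
  case sr : (s r) => [|y].
    apply: reach_step; rewrite /cm_step /= h1 h2 sr; congr pair.
    by rewrite -[LHS](upd_id s r) sr.
  apply: (@reach_trans _ _ (a, upd s r y)).
    by apply: reach_step; rewrite /cm_step /= h1 h2 sr.
  by rewrite -(upd_upd s r y 0); apply: IH; rewrite upd_same; lia.
- apply: reach_trans; first exact: IH1 (code_at_catl H).
  by apply: IH2; have := code_at_catr H; rewrite size_flat.
- by apply: reach_step; have [] := H 0 isT; rewrite addn0 /cm_step /= => -> ->; rewrite sr.
- apply: reach_trans; first exact: reach_step (loop_step H sr).
  by apply: reach_trans; [apply: IH1 (code_at_loop H)|apply: IH2].
Qed.

(** Under the invariant the head of the loop is visited again after arbitrarily many steps. A halted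
    machine never moves, so it could not return to an address inside the program. *)
Lemma loop_forever P r c a e (Inv : regs -> Prop) s :
  code_at P a (flat (Loop r c) a e) ->
  (forall s, Inv s -> exists y s', [/\ s r = y.+1, exec c (upd s r y) s' & Inv s']) ->
  Inv s -> forall t, (cm_run P t (a, s)).1 < size P.
Proof.
move=> H HI Is t.
have [u [s' [tu _ E]]] : exists u s', [/\ t <= u, Inv s' & cm_run P u (a, s) = (a, s')].
  elim: t => [|t [u [s' [tu Is' E]]]]; first by exists 0, s.
  have [y [s'' [sr ex Is'']]] := HI _ Is'.
  have [v Hv] := flat_exec ex (code_at_loop H).
  exists (u + v.+1), s''; split => //; first by lia.
  by rewrite cm_run_add E -add1n cm_run_add /= (loop_step H sr).
have [aP _] : a + 0 < size P /\ _ := H 0 isT.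
rewrite ltnNge; apply/negP => h; move: E.
rewrite -(subnKC tu) cm_run_add cm_run_halted // => E.
by move: h; rewrite E /= leqNgt -{1}(addn0 a) aP.
Qed.

(** A register can only be read by emptying it; [tmp] takes a second copy, from which [a] is
    restored. *)
Definition copy (a b tmp : nat) : cmd :=
  Seq (Loop a (Seq (Inc b) (Inc tmp))) (Loop tmp (Inc a)).
Definition move_to (a b : nat) : cmd := Loop a (Inc b).

Lemma exec_eq c s s1 s2 : exec c s s1 -> s1 = s2 -> exec c s s2.
Proof. by move=> H <-. Qed.

Ltac regs_case :=
  rewrite /upd;
  repeat (match goal with
          | |- context [if ?a == ?b then _ else _] => case: (a =P b) => [?|?]
          end; subst);
  try done; try lia.
Ltac regs_ext := apply: funext => ?; regs_case.

Lemma exec_move (a b : nat) s : a != b ->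
  exec (move_to a b) s (upd (upd s b (s a + s b)) a 0).
Proof.
move=> ab; have [n] := ubnP (s a); elim: n s => // n IH s sn.
case sa : (s a) => [|y].
  apply: exec_eq; first exact: ex_loop0.
  by regs_ext.
apply: (ex_loopS sa (ex_inc _ _)); apply: exec_eq; first apply: IH.
  by regs_case.
by regs_ext.
Qed.

Lemma exec_copy (a b tmp : nat) s : a != b -> a != tmp -> b != tmp -> s tmp = 0 ->
  exec (copy a b tmp) s (upd s b (s a + s b)).
Proof.
move=> ab at_ bt st.
have H : exec (Loop a (Seq (Inc b) (Inc tmp))) s
             (upd (upd (upd s b (s a + s b)) tmp (s a + s tmp)) a 0).
  have [n] := ubnP (s a); elim: n s {st} => // n IH s sn.
  case sa : (s a) => [|y].
    by apply: exec_eq; [apply: ex_loop0|regs_ext].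
  apply: (ex_loopS sa); first by apply: ex_seq; apply: ex_inc.
  by apply: exec_eq; [apply: IH; regs_case|regs_ext].
apply: ex_seq H _; apply: exec_eq; first by apply: exec_move; rewrite eq_sym.
by regs_ext.
Qed.

(** * Compiling recursive functions *)

Section RecfInd.
Variable Q : recf -> Prop.
Hypothesis Qzero : Q RZero.
Hypothesis Qsucc : Q RSucc.
Hypothesis Qproj : forall i, Q (RProj i).
Hypothesis Qcomp : forall f gs, Q f -> foldr (fun g X => Q g /\ X) True gs -> Q (RComp f gs).
Hypothesis Qprim : forall f g, Q f -> Q g -> Q (RPrim f g).
Hypothesis Qmu : forall f, Q f -> Q (RMu f).

(** The generated principle has no induction hypothesis for the functions listed in [RComp]; here
    [foldr] supplies one for each. *)
Fixpoint recf_nested_ind (f : recf) : Q f :=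
  match f with
  | RZero => Qzero
  | RSucc => Qsucc
  | RProj i => Qproj i
  | RComp f gs => Qcomp (recf_nested_ind f)
      ((fix all_gs gs : foldr (fun g X => Q g /\ X) True gs :=
          match gs with
          | [::] => I
          | g :: gs => conj (recf_nested_ind g) (all_gs gs)
          end) gs)
  | RPrim f g => Qprim (recf_nested_ind f) (recf_nested_ind g)
  | RMu f => Qmu (recf_nested_ind f)
  end.
End RecfInd.

Fixpoint clears (b k : nat) : cmd :=
  if k is j.+1 then Seq (Clr (b + j)) (clears b j) else Clr b.

(** With [C] abstracted outside the [fix], the guard condition accepts that [compile] calls itself
    on the members of a list. There is no idle command, so the sequence ends in [stop], which in
    [compile] clears a register that is already zero. *)
Definition seqs (C : recf -> nat -> cmd) (stop : cmd) : seq recf -> nat -> cmd :=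
  fix seqs gs i := if gs is g :: gs' then Seq (C g i) (seqs gs' i.+1) else stop.

(* [compile f args out b] puts the value of [f] at the registers [args] into the
   register [out], assuming that [out] and all registers from [b] on are zero, and
   restores all other registers. *)
Fixpoint compile (f : recf) (args : seq nat) (out b : nat) : cmd :=
  match f with
  | RZero => Clr out
  | RSucc => Seq (copy (nth 0 args 0) out b) (Inc out)
  | RProj i => copy (nth 0 args i) out b
  | RComp f gs =>
      Seq (seqs (fun g i => compile g args (b + i) (b + size gs)) (Clr (b + size gs)) gs 0)
        (Seq (compile f (iota b (size gs)) out (b + size gs)) (clears b (size gs)))
  | RPrim f g =>
      Seq (compile f (behead args) b.+1 (b + 4))
      (Seq (copy (nth 0 args 0) (b + 3) b.+2)
      (Seq (Loop (b + 3)
             (Seq (compile g [:: b, b.+1 & behead args] b.+2 (b + 4))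
             (Seq (Clr b.+1)
             (Seq (move_to b.+2 b.+1) (Inc b)))))
      (Seq (move_to b.+1 out) (Clr b))))
  | RMu f =>
      Seq (compile f (b :: args) b.+1 b.+2)
      (Seq (Loop b.+1
             (Seq (Clr b.+1)
             (Seq (Inc b) (compile f (b :: args) b.+1 b.+2))))
      (move_to b out))
  end.

(** Only defined values are claimed. Divergence is treated once, for the search over a total
    function. *)
Definition compiles (f : recf) : Prop := forall args out b s y,
  reval f [seq s r | r <- args] y -> s out = 0 -> (forall r, b <= r -> s r = 0) ->
  all (fun r => r < b) args -> out < b -> out \notin args ->
  exec (compile f args out b) s (upd s out y).

Definition load (s : regs) (b : nat) (ys : seq nat) : regs :=
  fun q => if b <= q then nth 0 ys (q - b) else s q.

Lemma map_eq_args (s s' : regs) b args : all (fun r => r < b) args ->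
  (forall r, r < b -> s r = s' r) -> [seq s r | r <- args] = [seq s' r | r <- args].
Proof. by move=> /allP H E; apply/eq_in_map => r /H /E. Qed.

Lemma load_nil s b : (forall r, b <= r -> s r = 0) -> load s b [::] = s.
Proof.
move=> z; apply: funext => q; rewrite /load nth_nil.
by case: leqP => // bq; rewrite z.
Qed.

Lemma load_rcons s b ys y : upd (load s b ys) (b + size ys) y = load s b (rcons ys y).
Proof.
apply: funext => q; rewrite /upd /load nth_rcons.
case: (q =P b + size ys) => [->|ne]; first by rewrite leq_addr addKn ltnn eqxx.
case: leqP => // bq; case: ltnP => // h; case: eqP => e; first by lia.
by rewrite nth_default.
Qed.

Lemma exec_clears s b k : (forall r, b + k <= r -> s r = 0) ->
  exec (clears b k) s (fun q => if b <= q then 0 else s q).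
Proof.
elim: k s => [|k IH] s z /=.
  apply: exec_eq; first exact: ex_clr.
  apply: funext => q; rewrite /upd; case: eqP => [->|ne]; first by rewrite leqnn.
  by case: leqP => // bq; rewrite z //; lia.
apply: ex_seq; first exact: ex_clr.
apply: exec_eq; first apply: IH.
  by move=> r h; rewrite /upd; case: eqP => // ne; apply: z; lia.
by apply: funext => q; rewrite /upd; case: leqP => // bq; case: eqP => // ?; lia.
Qed.

(** [dn] holds the values computed so far, stored from register [b] on; the induction along the list
    has to generalize over it. *)
Lemma exec_seqs args b k s gs ys dn :
  foldr (fun g X => compiles g /\ X) True gs ->
  revals gs [seq s r | r <- args] ys ->
  all (fun r => r < b) args -> size dn + size gs = k ->
  exec (seqs (fun g i => compile g args (b + i) (b + k)) (Clr (b + k)) gs (size dn))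
    (load s b dn) (load s b (dn ++ ys)).
Proof.
elim: gs ys dn => [|g gs IH] ys dn /=.
  move=> _ H _; inversion H; rewrite cats0 addn0 => <-.
  apply: exec_eq; first exact: ex_clr.
  apply: funext => q; rewrite /upd; case: eqP => // ->.
  by rewrite /load leq_addr addKn nth_default.
move=> [Hg Hgs] H ab sk; inversion H; subst => {H}.
apply: ex_seq.
  apply: Hg; last by apply/negP => /(allP ab); lia.
  - by rewrite -(map_eq_args ab (s := s)); [eassumption|move=> r h; rewrite /load leqNgt h].
  - by rewrite /load leq_addr addKn nth_default.
  - by move=> r h; rewrite /load nth_default; [case: ifP => //; lia|lia].
  - by apply: sub_all ab => r; lia.
  - by lia.
rewrite load_rcons -cat_rcons.
by rewrite -[(size dn).+1](size_rcons dn y); apply: IH => //; rewrite size_rcons; lia.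
Qed.

Lemma size_revals gs v ys : revals gs v ys -> size ys = size gs.
Proof.
by elim: gs ys => [|g gs IH] ys H; inversion H; subst => //=; rewrite IH.
Qed.

Lemma compiles_comp f gs : compiles f ->
  foldr (fun g X => compiles g /\ X) True gs -> compiles (RComp f gs).
Proof.
move=> Hf Hgs args out b s y H so z ab ob oa; inversion H; subst => {H}.
have sy := size_revals H2.
apply: ex_seq.
  have := @exec_seqs args b (size gs) s gs ys [::] Hgs H2 ab erefl.
  rewrite load_nil // cat0s => H; exact: H.
apply: ex_seq.
  apply: Hf; last by rewrite mem_iota; lia.
  - have -> : [seq load s b ys r | r <- iota b (size gs)] = ys; last by eassumption.
    rewrite -sy -[RHS](@seq_iota_nth ys _ erefl) -[b in iota b]addn0 iotaDl -map_comp.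
    by apply: eq_map => i /=; rewrite /load leq_addr addKn.
  - by rewrite /load leqNgt ob.
  - by move=> r h; rewrite /load nth_default; [case: ifP => //; lia|lia].
  - by apply/allP => r; rewrite mem_iota; lia.
  - by lia.
apply: exec_eq; first apply: exec_clears.
  move=> r h; rewrite /upd /load; case: eqP; first by lia.
  by move=> _; rewrite nth_default; [case: ifP => //; lia|lia].
apply: funext => q; rewrite /upd /load; case: leqP => h.
  by case: eqP => [?|_]; [lia|rewrite z].
by [].
Qed.

(** Makes the intermediate values a function of the counter, so that the invariant of the machine
    loop can name them. *)
Lemma reval_prim_chain f g n v y : reval (RPrim f g) (n :: v) y ->
  exists rs : nat -> nat, [/\ reval f v (rs 0), rs n = y &
    forall i, i < n -> reval g [:: i, rs i & v] (rs i.+1)].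
Proof.
elim: n y => [|n IH] y H; inversion H; subst => {H}; first by exists (fun=> y).
edestruct IH as [rs [h0 hn hS]]; first eassumption.
exists (fun i => if i <= n then rs i else y); split => //; first by rewrite ltnn.
move=> i; rewrite ltnS leq_eqVlt => /orP[/eqP ->|lt_in].
  by rewrite eqxx ltnn hn.
by rewrite lt_in orbT; apply: hS.
Qed.

Lemma compiles_prim f g : compiles f -> compiles g -> compiles (RPrim f g).
Proof.
move=> Hf Hg [|a args] out b s y H so z /=; first by inversion H.
move=> /andP[ab argb] ob; rewrite inE negb_or => /andP[oa oargs].
have [rs [h0 hn hS]] := reval_prim_chain H.
(* State between two rounds: [b] counts up, [b.+1] accumulates, [b + 3] holds the number of rounds
   left, and [b.+2], which receives each new value, is back to zero. *)
pose st i r n := upd (upd (upd s b i) b.+1 r) (b + 3) n.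
have st_low i r n q : q < b -> st i r n q = s q.
  by move=> h; rewrite /st; regs_case.
have inargs q : q \in args -> q < b by move/(allP argb).
apply: (@ex_seq _ _ _ (upd s b.+1 (rs 0))).
  apply: Hf => //; try by [lia|rewrite z]; last by apply/negP => /inargs; lia.
  - by move=> r h; rewrite z //; lia.
  - by apply: sub_all argb => r; lia.
apply: (@ex_seq _ _ _ (st 0 (rs 0) (s a))).
  apply: exec_eq; first apply: exec_copy; try lia.
    by rewrite /upd; case: eqP => [|_]; [lia|rewrite z //; lia].
  have zb := z b; have z3 := z (b + 3).
  by rewrite /st; apply: funext => q; regs_case; rewrite ?zb ?z3 //; lia.
apply: (@ex_seq _ _ _ (st (s a) y 0)).
  rewrite -hn.
  have L j i : i + j = s a -> exec (Loop (b + 3)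
             (Seq (compile g [:: b, b.+1 & args] b.+2 (b + 4))
             (Seq (Clr b.+1)
             (Seq (move_to b.+2 b.+1) (Inc b))))) (st i (rs i) j) (st (s a) (rs (s a)) 0).
    elim: j i => [|j IH] i ij.
      rewrite addn0 in ij; rewrite ij; apply: ex_loop0.
      by rewrite /st upd_same.
    apply: (@ex_loopS _ _ _ (st i.+1 (rs i.+1) j) _ j); last by apply: IH; lia.
      by rewrite /st upd_same.
    rewrite {1}/st upd_upd -/(st i (rs i) j).
    apply: (@ex_seq _ _ _ (upd (st i (rs i) j) b.+2 (rs i.+1))).
      apply: Hg; try lia.
      - have -> : [seq st i (rs i) j r | r <- [:: b, b.+1 & args]] =
            [:: i, rs i & [seq s r | r <- args]].
          rewrite /= (map_eq_args argb (st_low i (rs i) j)) /st.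
          by congr [:: _, _ & _]; regs_case.
        by apply: hS; lia.
      - by rewrite /st; regs_case; rewrite z //; lia.
      - by move=> r h; rewrite /st; regs_case; rewrite z //; lia.
      - by rewrite /=; apply/and3P; split; try lia; apply: sub_all argb => r; lia.
      - by rewrite !inE; apply/negP => /or3P[/eqP|/eqP|/inargs]; lia.
    apply: ex_seq; first exact: ex_clr.
    apply: ex_seq; first by apply: exec_move; lia.
    apply: exec_eq; first exact: ex_inc.
    have z2 : s b.+2 = 0 by rewrite z //; lia.
    by rewrite /st; apply: funext => q; regs_case.
  by apply: L; rewrite add0n.
apply: (@ex_seq _ _ _ (upd (st (s a) 0 0) out y)).
  apply: exec_eq; first by apply: exec_move; lia.
  by rewrite /st; apply: funext => q; regs_case.
apply: exec_eq; first exact: ex_clr.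
have zb := z b (leqnn b); have z1 := z b.+1 (leqnSn b); have z3 := z (b + 3) (leq_addr _ _).
by rewrite /st; apply: funext => q; regs_case.
Qed.

Section MuLoop.
Variables (f : recf) (args : seq nat) (b : nat) (s : regs).
Hypothesis Hf : compiles f.
Hypothesis z : forall r, b <= r -> s r = 0.
Hypothesis ab : all (fun r => r < b) args.

Definition mu_state (m y : nat) : regs := upd (upd s b m) b.+1 y.
Definition mu_body : cmd :=
  Seq (Clr b.+1) (Seq (Inc b) (compile f (b :: args) b.+1 b.+2)).

Lemma exec_mu_test m y : reval f (m :: [seq s r | r <- args]) y ->
  exec (compile f (b :: args) b.+1 b.+2) (mu_state m 0) (mu_state m y).
Proof.
move=> H; apply: exec_eq.
  apply: Hf.
  - have -> : [seq mu_state m 0 r | r <- b :: args] = m :: [seq s r | r <- args].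
      rewrite /= {1}/mu_state; congr cons; first by regs_case.
      by apply: map_eq_args ab _ => r h; rewrite /mu_state; regs_case.
    exact: H.
  - by rewrite /mu_state; regs_case.
  - by move=> r h; rewrite /mu_state; regs_case; apply: z; lia.
  - by rewrite /=; apply/andP; split; [lia|apply: sub_all ab => r; lia].
  - by lia.
  - by rewrite inE; apply/negP => /orP[/eqP|/(allP ab)]; lia.
by rewrite /mu_state upd_upd.
Qed.

Lemma exec_mu_body m x y : reval f (m.+1 :: [seq s r | r <- args]) y ->
  exec mu_body (mu_state m x) (mu_state m.+1 y).
Proof.
move=> H; apply: ex_seq; first exact: ex_clr.
apply: ex_seq; last exact: exec_mu_test H.
by apply: exec_eq; [apply: ex_inc|rewrite /mu_state; regs_ext].
Qed.

(** [y] stands for the value of [f] at [m]. The equality of the two tests says that it vanishes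
    exactly when the search has arrived at [n], which is when the loop stops. *)
Lemma exec_mu_loop m n y : m <= n ->
  reval f (n :: [seq s r | r <- args]) 0 ->
  (forall m, m < n -> exists k, reval f (m :: [seq s r | r <- args]) k.+1) ->
  (m == n) = (y == 0) ->
  exec (Loop b.+1 mu_body) (mu_state m y) (mu_state n 0).
Proof.
move=> mn Hn Hlt; have [j] := ubnP (n - m); elim: j m y mn => // j IH m y mn nm.
case: eqP => [-> /esym /eqP -> |ne /esym y0].
  by apply: ex_loop0; rewrite /mu_state upd_same.
case: y y0 => // y _.
have lmn : m < n by lia.
have [y' [Hy' e]] : exists y', reval f (m.+1 :: [seq s r | r <- args]) y' /\
    (m.+1 == n) = (y' == 0).
  case: (m.+1 =P n) => [->|?]; first by exists 0.
  by have [|k Hk] := Hlt m.+1; [lia|exists k.+1].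
apply: (@ex_loopS _ _ _ (mu_state m.+1 y') _ y); first by rewrite /mu_state upd_same.
  by rewrite /mu_state upd_upd; apply: exec_mu_body.
by apply: IH => //; lia.
Qed.

End MuLoop.

Lemma compiles_mu f : compiles f -> compiles (RMu f).
Proof.
move=> Hf args out b s n H so z ab ob oa; inversion H; subst.
have zb := z b (leqnn b); have z1 := z b.+1 (leqnSn b).
have [y [Hy e]] : exists y, reval f (0 :: [seq s r | r <- args]) y /\
    (0 == n) = (y == 0).
  case: (n) H1 H2 => [H1 _|m _ H2]; first by exists 0.
  by have [//|k Hk] := H2 0; exists k.+1.
have st0 : mu_state b s 0 0 = s by rewrite /mu_state; regs_ext.
apply: ex_seq; first by rewrite -{1}st0; apply: exec_mu_test Hy.
apply: ex_seq; first by apply: exec_mu_loop e.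
apply: exec_eq; first by apply: exec_move; lia.
by rewrite /mu_state; regs_ext.
Qed.

Lemma compile_correct f : compiles f.
Proof.
elim/recf_nested_ind: f.
- move=> args out b s y H so _ _ _ _; inversion H; subst; apply: ex_clr.
- move=> [|a args] out b s y H so z ab ob oa; inversion H; subst.
  move: ab oa; rewrite /= inE negb_or => /andP[ab _] /andP[oa _].
  apply: ex_seq; first by apply: exec_copy; [lia|lia|lia|rewrite z].
  by apply: exec_eq; [apply: ex_inc|rewrite so addn0; regs_ext].
- move=> i args out b s y H so z ab ob oa; inversion H; subst.
  rewrite size_map in H1; have ia := mem_nth 0 H1.
  apply: exec_eq.
    apply: exec_copy; last by rewrite z.
    + by apply: contraNneq oa => <-.
    + by move/allP: ab => /(_ _ ia) /=; lia.
    + by lia.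
  by rewrite so addn0 (nth_map 0).
- exact: compiles_comp.
- exact: compiles_prim.
- exact: compiles_mu.
Qed.

(* The machine that tests [f [:: t; n]] for t = 0, 1, ... until it finds a zero. *)
Definition search_machine (f : recf) : seq instr :=
  let c := compile (RMu f) [:: 0] 1 2 in flat c 0 (clen c).

Lemma code_at_self l : code_at l 0 l.
Proof. by move=> i il; rewrite add0n. Qed.

(** If there is a zero, the compiled minimization leaves to the address just past the program.
    Otherwise every tested value is positive, so the loop is entered again forever. *)
Lemma search_machineP f n (F : nat -> nat) : (forall t, reval f [:: t; n] (F t)) ->
  cm_halts (search_machine f) n <-> exists t, F t = 0.
Proof.
move=> tot; set P := search_machine f; set s : regs := upd (fun=> 0) 0 n.
have z r : 2 <= r -> s r = 0 by rewrite /s; regs_case.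
have sP : size P = clen (compile (RMu f) [:: 0] 1 2) by rewrite size_flat.
split=> [hlt|ex0]; last first.
  have ex0' : exists t, F t == 0 by case: ex0 => t /eqP; exists t.
  case: (ex_minnP ex0') => t /eqP Ht Hmin.
  have : exec (compile (RMu f) [:: 0] 1 2) s (upd s 1 t).
    apply: compile_correct => //; rewrite /= {1}/s upd_same; apply: ev_mu => [|m mt].
      by rewrite -Ht; apply: tot.
    have := tot m; have := Hmin m; rewrite leqNgt mt.
    by case: (F m) => [/(_ isT)|k _ Hk] //; exists k.
  move=> /flat_exec /(_ (@code_at_self P))[u Hu]; exists u.
  by rewrite /cm_init -/s Hu -/P sP.
apply: contrapT => no0; have nz t : 0 < F t.
  by case e : (F t) => //; case: no0; exists t.
set a := clen (compile f [:: 2; 0] 3 4).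
set c := mu_body f [:: 0] 2.
have CA : code_at P 0 (flat (compile (RMu f) [:: 0] 1 2) 0 (size P)).
  by rewrite sP; apply: code_at_self.
have [u Hu] : reach P (cm_init n) (a, mu_state 2 s 0 (F 0)).
  have st0 : mu_state 2 s 0 0 = s by rewrite /mu_state /s; regs_ext.
  rewrite /cm_init -/s -{1}st0; apply: (flat_exec _ (code_at_catl CA)).
  by apply: exec_mu_test => //; exact: compile_correct.
have CL : code_at P a (flat (Loop 3 c) a (a + (clen c).+1)).
  by have := code_at_catl (code_at_catr CA); rewrite size_flat.
pose Inv s' := exists t y, s' = mu_state 2 s t y /\ 0 < y.
have L t : (cm_run P t (a, mu_state 2 s 0 (F 0))).1 < size P.
  apply: (loop_forever (Inv := Inv) CL); last by exists 0, (F 0).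
  move=> _ [u' [[|y] [-> // _]]].
  exists y, (mu_state 2 s u'.+1 (F u'.+1)); split.
  - by rewrite /mu_state upd_same.
  - rewrite /mu_state upd_upd; apply: exec_mu_body => //; exact: compile_correct.
  - by exists u'.+1, (F u'.+1).
case: hlt => t Ht; have := L t; rewrite -Hu -cm_run_add addnC cm_run_add.
by rewrite (cm_run_halted _ Ht) ltnNge Ht.
Qed.

(** * A machine with undecidable halting problem *)

Fixpoint reg_prime (r : nat) : nat :=
  if r is q.+1 then s2val (prime_above (reg_prime q)) else 2.

Lemma reg_prime_prime r : prime (reg_prime r).
Proof. by case: r => //= r; case: prime_above. Qed.

Lemma reg_prime_inj : injective reg_prime.
Proof.
have H r d : reg_prime r < reg_prime (r + d.+1).
  elim: d => [|d IH]; first by rewrite addn1 /=; case: prime_above.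
  by apply: ltn_trans IH _; rewrite [r + d.+2]addnS /=; case: prime_above.
move=> r q e; case: (ltngtP r q) => // h.
  have := H r (q - r).-1; have -> : r + (q - r).-1.+1 = q by lia.
  by rewrite e ltnn.
have := H q (r - q).-1; have -> : q + (r - q).-1.+1 = r by lia.
by rewrite e ltnn.
Qed.

(** A Gödel number of the first [K] registers: incrementing is multiplication by a prime, and a zero
    test is a divisibility test. *)
Definition regs_code (K : nat) (s : regs) : nat := \prod_(r < K) reg_prime r ^ s r.

Lemma regs_code_upd K s r x : r < K ->
  regs_code K (upd s r x) = reg_prime r ^ x * \prod_(i < K | i != r :> nat) reg_prime i ^ s i.
Proof.
move=> rK; rewrite /regs_code (bigD1 (Ordinal rK)) //= upd_same; congr (_ * _).
by apply: eq_big => // i ir; rewrite upd_other.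
Qed.

Lemma regs_code_inc K s r : r < K ->
  regs_code K (upd s r (s r).+1) = regs_code K s * reg_prime r.
Proof.
move=> rK; rewrite -[in RHS](upd_id s r) !regs_code_upd // expnS.
by rewrite -mulnA [RHS]mulnC.
Qed.

Lemma regs_code_zero K s r : r < K -> s r = 0 -> regs_code K s %% reg_prime r != 0.
Proof.
move=> rK sr; rewrite -(upd_id s r) regs_code_upd // sr mul1n -/(dvdn _ _).
have P i := reg_prime_prime i.
apply: (big_ind (fun x => ~~ (reg_prime r %| x))).
- by rewrite dvdn1; apply/eqP => e; have := P r; rewrite e.
- by move=> x y hx hy; rewrite Euclid_dvdM // negb_or hx.
- move=> i ir; rewrite Euclid_dvdX // dvdn_prime2 // negb_and; apply/orP; left.
  by apply: contra ir => /eqP /reg_prime_inj ->.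
Qed.

(** A multiplier, a divisor and the next addresses for exact and inexact division, in the manner of
    Conway's fraction programs. An increment divides by 1, a decrement multiplies by 1. No divisor
    is 0, so a 0 read beyond the program signals halting. *)
Definition instr_code (i : instr) : seq nat :=
  match i with
  | INC r j => [:: reg_prime r; 1; j; 0]
  | DEC r j k => [:: 1; reg_prime r; j; k]
  end.

Definition cm_code (P : seq instr) : nat := CodeSeq.code (flatten (map instr_code P)).

Lemma cm_code_nth P pc i : i < 4 ->
  code_nth (cm_code P) (4 * pc + i) =
  if pc < size P then nth 0 (instr_code (nth (INC 0 0) P pc)) i else 0.
Proof.
move=> i4; rewrite code_nthP; elim: P pc => [|x P IH] pc; first by rewrite /= nth_nil.
have sx : size (instr_code x) = 4 by case: x.
rewrite /= nth_cat sx; case: pc => [|pc]; first by rewrite muln0 add0n i4.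
by rewrite mulnS -addnA ltnNge leq_addr /= addKn IH.
Qed.

(** Where it is used, [d.-1.+1] equals [d]; this form is positive for all arguments, as the
    computability of division demands. *)
Definition interp_step (c st : nat) : nat :=
  let pc := code_head st in
  let N := code_tail st in
  let d := code_nth c (4 * pc + 1) in
  if d == 0 then st
  else if N %% d.-1.+1 == 0
       then code_cons (code_nth c (4 * pc + 2)) (N %/ d.-1.+1 * code_nth c (4 * pc + 0))
       else code_cons (code_nth c (4 * pc + 3)) N.

(** The program coded by [c] is run on [c] itself: 2 is the prime of register 0, so [2 ^ c] is the
    initial register code. The result is the divisor at the current address, which is 0 only after
    halting. *)
Definition interp (t c : nat) : nat :=
  code_nth c (4 * code_head (iter t (interp_step c) (code_cons 0 (2 ^ c))) + 1).

Definition instr_reg (i : instr) : nat := match i with INC r _ => r | DEC r _ _ => r end.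

Lemma interp_stepP P K pc s : all (fun i => instr_reg i < K) P ->
  let x := cm_step P (pc, s) in
  interp_step (cm_code P) (code_cons pc (regs_code K s)) = code_cons x.1 (regs_code K x.2).
Proof.
move=> aK; rewrite /interp_step code_head_cons code_tail_cons !cm_code_nth // /cm_step /=.
case: ltnP => // pcP; have := all_nthP (INC 0 0) aK _ pcP.
have p0 r : 0 < reg_prime r by apply: prime_gt0; apply: reg_prime_prime.
case: nth => [r j|r j k] /= rK.
  by rewrite modn1 divn1 regs_code_inc.
rewrite (gtn_eqF (p0 r)) prednK //.
case sr : (s r) => [|y] /=; first by rewrite (negPf (regs_code_zero rK sr)).
have -> : regs_code K s = regs_code K (upd s r y) * reg_prime r.
  have := @regs_code_inc K (upd s r y) r rK.
  by rewrite upd_same upd_upd -sr upd_id.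
by rewrite modnMl mulnK // muln1.
Qed.

Lemma interpP P t c : c = cm_code P ->
  (interp t c == 0) = (size P <= (cm_run P t (cm_init c)).1).
Proof.
move=> -> {c}; set c := cm_code P.
pose K := (\max_(i <- P) instr_reg i).+1.
have aK : all (fun i => instr_reg i < K) P.
  elim: P @K {c} => //= i P IH; rewrite big_cons ltnS leq_maxl /=.
  by apply: sub_all IH => j h; rewrite ltnS leq_max; move: h; rewrite ltnS => ->; rewrite orbT.
have -> : interp t c = code_nth c (4 * (cm_run P t (cm_init c)).1 + 1).
  rewrite /interp.
  suff -> : iter t (interp_step c) (code_cons 0 (2 ^ c)) =
    code_cons (cm_run P t (cm_init c)).1 (regs_code K (cm_run P t (cm_init c)).2).
    by rewrite code_head_cons.
  elim: t => [|t IH] /=; last first.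
    by rewrite IH interp_stepP // -surjective_pairing.
  rewrite regs_code_upd //= big1 ?muln1 //.
rewrite cm_code_nth //; case: ltnP => // h.
have p0 r : reg_prime r != 0 by rewrite -lt0n; apply: prime_gt0; apply: reg_prime_prime.
by case: (nth (INC 0 0) _ _) => //= r j k; rewrite (negPf (p0 r)).
Qed.

(** * Computability of the interpreter and diagonalization *)

Lemma total_rec_interp : total_rec 2 (fun v => interp (nth 0 v 0) (nth 0 v 1)).
Proof.
have V k i : i < k -> total_rec k (fun v => nth 0 v i) by apply: total_rec_var.
have C k i : total_rec k (fun=> i) by apply: total_rec_const.
have H k (c st : seq nat -> nat) : total_rec k c -> total_rec k st ->
    total_rec k (fun v => interp_step (c v) (st v)).
  move=> Hc Hst.
  have Hf i : total_rec k (fun v => code_nth (c v) (4 * code_head (st v) + i)).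
    apply: total_rec_nth => //; apply: total_rec_add => //.
    by apply: total_rec_mul => //; apply: total_rec_head.
  have HN : total_rec k (fun v => code_tail (st v)) by apply: total_rec_tail.
  have Hd : total_rec k (fun v => (code_nth (c v) (4 * code_head (st v) + 1)).-1.+1).
    by apply: total_rec_succ; apply: total_rec_pred.
  apply: total_rec_if => //; first exact: total_rec_eq0.
  apply: total_rec_if; first by apply: total_rec_eq0; apply: total_rec_mod.
    by apply: total_rec_cons => //; apply: total_rec_mul => //; apply: total_rec_div.
  exact: total_rec_cons.
apply: total_rec_nth; first exact: V.
apply: total_rec_add => //; apply: total_rec_mul => //; apply: total_rec_head.
apply: (@total_rec_ext _ (fun v => iteri (nth 0 v 0)
   (fun _ r => interp_step (nth 0 v 1) r) (code_cons 0 (2 ^ nth 0 v 1)))) => [v _|].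
  by elim: (nth 0 v 0) => //= n ->.
apply: (total_rec_iteri (G := fun _ r v => interp_step (nth 0 v 1) r)).
- exact: V.
- by apply: total_rec_cons => //; apply: total_rec_exp => //; apply: V.
- apply: H; last exact: V.
  exact: (total_rec_behead (total_rec_behead (V 2 1 isT))).
Qed.

(** From a decider [d] one builds [P], whose search ignores the time and asks only whether [d]
    answers 0. On its own code [P] halts exactly when [search_machine U] does not, whereas
    [search_machine U] halts on that code exactly when [P] does. *)
Lemma undecidable_machine : exists P, undecidable_set (cm_halts P).
Proof.
have [U HU] := total_rec_interp.
exists (search_machine U) => -[d Hd].
pose D := RComp d [:: RProj 1].
have HD t n y : reval d [:: n] y -> reval D [:: t; n] y.
  move=> H; apply: ev_comp H; apply: evs_cons; last exact: evs_nil.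
  exact: (@ev_proj 1 [:: t; n]).
pose F n := if `[< cm_halts (search_machine U) n >] then 1 else 0.
have HF n : reval d [:: n] (F n).
  by rewrite /F; case: (Hd n) => -[h ?]; [rewrite asboolT|rewrite asboolF].
pose P := search_machine D; pose c := cm_code P.
have := @search_machineP D c (fun=> F c) (fun t => HD t c _ (HF c)).
have := @search_machineP U c (fun t => interp t c) (fun t => HU [:: t; c] erefl).
rewrite -/P => H1 H2.
have H3 : cm_halts P c <-> exists t, interp t c = 0.
  split=> -[t Ht]; exists t; first by apply/eqP; rewrite (interpP t (erefl (cm_code P))).
  by rewrite -(interpP t (erefl (cm_code P))) -/c Ht.
have [h|h] := pselect (cm_halts (search_machine U) c).
  by have [_] := H2.1 (H3.2 (H1.1 h)); rewrite /F asboolT.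
by apply/h/H1.2/H3.1/H2.2; exists 0; rewrite /F asboolF.
Qed.

(** * The frame and the local rules *)

Definition instr_bounded (K M : nat) (i : instr) : bool :=
  match i with
  | INC r j => (r < K) && (j < M)
  | DEC r j k => [&& r < K, j < M & k < M]
  end.

HB.instance Definition _ := gen_eqMixin pathograph.

(** Without urpaths a pathograph has one realization up to isomorphism, so containment reduces to an
    induced embedding. *)
Lemma contains_no_urpath n (adj : rel 'I_n) F : pg_nu F = 0 ->
  contains_pg adj F <->
  exists h : nat -> 'I_n,
    {in gtn (pg_nv F) &, injective h} /\
    {in gtn (pg_nv F) &, forall a b, adj (h a) (h b) = pg_edge F a b}.
Proof.
move=> nu0; split.
  move=> [X [f [g [m [sp [rg]]]]]] [_ [_ [_ [fi [_ [_ [_ [fe _]]]]]]]].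
  by exists f; split=> a b; [apply: fi|apply: fe].
move=> [h [hi he]]; exists [set x in [seq h a | a <- iota 0 (pg_nv F)]].
exists h, (fun _ _ => h 0), (fun=> 0), (fun _ _ _ => false), (fun _ _ _ _ => false).
rewrite nu0.
split=> [//|]; split.
  move=> a av; rewrite /= in_set; apply: map_f; rewrite mem_iota add0n //.
split=> [//|]; split.
  by move=> a b av bv; apply: hi.
split=> [//|]; split=> [//|]; split.
  move=> x; rewrite /= in_set => /mapP[a]; rewrite mem_iota add0n => av ->.
  by left; exists a.
split=> [a b av bv|]; first exact: he.
by do 3 split=> //.
Qed.

Section Gadget.
Variables (P : seq instr) (K M : nat).

(** The order is time, registers, program counters, input. The input path comes last so that the
    remaining paths are exactly the urpaths [0] to [K.+1] when it is built from ordinary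
    vertices. *)
Definition pT := 0.
Definition pR (r : nat) := r.+1.
Definition pPC := K.+1.
Definition pI := K.+2.
Definition npaths := K.+3.

(* Anchors 0 and 1 are the two ends of every path, anchor 2 marks the input. *)
Definition anc (p c : nat) := 3 + p * M + c.
Definition nanc := 3 + npaths * M.
(** Two more than the anchors, because in the graph of a run a clique that leaves the frame clique
    has at most [nanc + 1] vertices. *)
Definition nclq := nanc + 2.
Definition nfr := nanc + nclq.

(* The frame: the vertices from [nanc] on form a clique, which is the only clique of
   its size; anchor [i] sees exactly [i + 1] vertices of it. *)
Definition fedge (i j : nat) : bool :=
  [|| [&& nanc <= i, nanc <= j & i != j],
      [&& i < nanc, nanc <= j & j - nanc <= i] |
      [&& j < nanc, nanc <= i & i - nanc <= j]].

Section Rules.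
Variables (lab adj eqr : nat -> nat -> bool).

Definition col (i p c : nat) : bool := [&& p < npaths, c < M & lab i (anc p c)].
Definition nextc (c : nat) := c.+1 %% M.

(* The rules that any five elements (with repetitions) have to satisfy. *)
Record good : Prop := Good {
  good_col : exists p c, col 0 p c;
  good_col_uniq : forall p c p' c', col 0 p c -> col 0 p' c' -> p = p' /\ c = c';
  good_start0 : forall p c, lab 0 0 -> col 0 p c -> col 0 p 0;
  good_start1 : forall p c, lab 0 0 -> col 0 p 0 -> col 1 p c -> adj 0 1 -> col 1 p (nextc 0);
  good_next : forall p c d, col 0 p c -> col 1 p (nextc c) -> col 2 p d ->
    adj 0 1 -> adj 1 2 -> ~~ eqr 0 2 -> col 2 p (nextc (nextc c));
  good_mark : lab 0 2 -> ~~ lab 0 1;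
  good_diag0 : lab 0 0 -> col 0 pI 0 -> lab 1 0 -> col 1 (pR 0) 0 -> adj 0 1;
  good_diag : forall c, col 0 pI c -> col 1 pI (nextc c) -> adj 0 1 ->
    col 2 (pR 0) c -> col 3 (pR 0) (nextc c) -> adj 2 3 -> adj 0 2 -> adj 1 3;
  good_room : forall p r c d, p = pI \/ p = pT -> r < K -> col 0 p c ->
    col 1 (pR r) d -> adj 0 1 -> ~~ lab 1 1;
  good_init_input : forall c d, lab 0 0 -> col 0 pT 0 -> lab 1 2 -> col 1 pI c ->
    col 2 (pR 0) d -> adj 1 2 -> adj 0 2;
  good_init_reg : forall r, 0 < r < K -> lab 0 0 -> col 0 pT 0 ->
    lab 1 0 -> col 1 (pR r) 0 -> adj 0 1;
  good_init_pc : lab 0 0 -> col 0 pT 0 -> col 1 pPC 0 -> adj 0 1;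
  good_final : forall c q, lab 0 1 -> col 0 pT c -> q < size P -> col 1 pPC q -> ~~ adj 0 1;
  good_frame : forall c q r d, q < size P -> col 0 pT c -> col 1 pT (nextc c) ->
    adj 0 1 -> col 2 pPC q -> adj 0 2 ->
    r < K -> r <> instr_reg (nth (INC 0 0) P q) ->
    col 3 (pR r) d -> adj 0 3 -> adj 1 3;
  good_step : forall c q, q < size P -> col 0 pT c -> col 1 pT (nextc c) ->
    adj 0 1 -> col 2 pPC q -> adj 0 2 ->
    match nth (INC 0 0) P q with
    | INC r j => (col 3 pPC j -> adj 1 3) /\
        (forall d, col 3 (pR r) d -> col 4 (pR r) (nextc d) -> adj 3 4 -> adj 0 3 -> adj 1 4)
    | DEC r j k => forall d, col 3 (pR r) d -> adj 0 3 ->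
        if lab 3 0 then adj 1 3 /\ (col 4 pPC k -> adj 1 4)
        else (col 4 pPC j -> adj 1 4) /\
             (forall d', d = nextc d' -> col 4 (pR r) d' -> adj 3 4 -> adj 1 4)
    end
}.
End Rules.

(** Since labels, adjacency and equality are parameters of [good], the same rules speak of a
    pattern, of an arbitrary realization and of the graph of a run. *)
Definition pattern_good (F : pathograph) (rho : nat -> nat) : Prop :=
  good (fun i a => (a < nanc) && pg_edge F a (nfr + rho i))
       (fun i j => pg_edge F (nfr + rho i) (nfr + rho j))
       (fun i j => rho i == rho j).

Definition framed (F : pathograph) : Prop :=
  [/\ pg_nu F = 0, nfr <= pg_nv F &
      {in gtn nfr &, forall a b, pg_edge F a b = fedge a b}].

(** [rho] places the elements mentioned by the rules on vertices outside the frame, possibly several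
    on one vertex. *)
Definition bad_pattern (F : pathograph) : Prop :=
  framed F /\ exists2 rho : nat -> nat,
    forall i, nfr + rho i < pg_nv F & ~ pattern_good F rho.

Definition all_pairs (n : nat) : seq (nat * nat) :=
  [seq (a, b) | a <- iota 0 n, b <- iota 0 n].

Definition graphs (n : nat) : seq pathograph :=
  [seq Pathograph n 0 (mask (tval m) (all_pairs n)) [::] [::] [::]
     | m <- enum {: (size (all_pairs n)).-tuple bool}].

(** No rule mentions more than five elements, so five vertices beyond the frame suffice. The
    selection is classical; the code of this list enters the reduction only as a constant. *)
Definition bad_patterns : seq pathograph :=
  [seq F <- flatten [seq graphs (nfr + k) | k <- iota 0 6] | pg_wf F && `[< bad_pattern F >]].

Lemma bad_patterns_wf : all pg_wf bad_patterns.
Proof. by apply/allP => F; rewrite mem_filter => /andP[/andP[]]. Qed.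

Lemma bad_patterns_mem F : (F \in bad_patterns) -> bad_pattern F.
Proof. by rewrite mem_filter => /andP[/andP[_ /asboolP]]. Qed.

End Gadget.

Lemma mem_all_pairs n a b : ((a, b) \in all_pairs n) = (a < n) && (b < n).
Proof.
apply/allpairsP/andP => [[[x y] /= [hx hy [-> ->]]]|[an bn]].
  by move: hx hy; rewrite !mem_iota.
by exists (a, b); rewrite !mem_iota.
Qed.

Lemma graphs_filter n (t : pred (nat * nat)) :
  Pathograph n 0 (filter t (all_pairs n)) [::] [::] [::] \in graphs n.
Proof.
rewrite filter_mask.
have sz : size (map t (all_pairs n)) == size (all_pairs n) by rewrite size_map.
by apply/mapP; exists (Tuple sz); rewrite ?mem_enum.
Qed.

(** * The local rules in a graph without bad patterns *)

Section Extract.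
Variables (P : seq instr) (K M : nat).
Variables (n : nat) (adj : rel 'I_n).
Hypothesis adjG : simple_graph adj.
Variable fr : nat -> 'I_n.
Hypothesis fr_inj : {in gtn (nfr K M) &, injective fr}.
Hypothesis fr_adj : {in gtn (nfr K M) &, forall a b, adj (fr a) (fr b) = fedge K M a b}.
Hypothesis free : forall F, F \in bad_patterns P K M -> ~ contains_pg adj F.

(** Otherwise the subgraph induced on the frame and the distinct members of [xs] would be a bad
    pattern, with [rho] restoring the repetitions. *)
Lemma free_good (x0 x1 x2 x3 x4 : 'I_n) :
  let xs := [:: x0; x1; x2; x3; x4] in
  (forall a x, a < nfr K M -> x \in xs -> fr a != x) ->
  good P K M (fun i a => (a < nanc K M) && adj (fr a) (nth x0 xs i))
       (fun i j => adj (nth x0 xs i) (nth x0 xs j))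
       (fun i j => nth x0 xs i == nth x0 xs j).
Proof.
move=> xs fr_xs; apply: contrapT => nogood.
have [sym irr] := adjG.
pose ys := undup xs; pose N := nfr K M + size ys.
have ys_xs y : (y \in ys) = (y \in xs) by rewrite mem_undup.
have sys : size ys <= 5 by apply: size_undup.
have ltA a : a < nanc K M -> a < nfr K M by rewrite /nfr; lia.
pose emb a := if a < nfr K M then fr a else nth x0 ys (a - nfr K M).
have emb_inj : {in gtn N &, injective emb}.
  move=> a b; rewrite !inE /= /emb => aN bN.
  case: ltnP => ha; case: ltnP => hb.
  - exact: fr_inj.
  - move=> e; have h : nth x0 ys (b - nfr K M) \in xs.
      by rewrite -ys_xs mem_nth //; rewrite /N in bN; lia.
    by have := fr_xs a _ ha h; rewrite e eqxx.
  - move=> e; have h : nth x0 ys (a - nfr K M) \in xs.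
      by rewrite -ys_xs mem_nth //; rewrite /N in aN; lia.
    by have := fr_xs b _ hb h; rewrite e eqxx.
  - move/eqP; rewrite nth_uniq ?undup_uniq //; rewrite /N in aN bN *; try lia.
pose t p := adj (emb p.1) (emb p.2).
pose F := Pathograph N 0 (filter t (all_pairs N)) [::] [::] [::].
have FE : {in gtn N &, forall a b, pg_edge F a b = adj (emb a) (emb b)}.
  move=> a b; rewrite !inE /= => aN bN.
  rewrite /pg_edge -[pg_E F]/(filter t (all_pairs N)) !mem_filter !mem_all_pairs aN bN /t !andbT.
  by rewrite [adj (emb b) _]sym orbb.
apply: (free (F := F)); last first.
  apply/contains_no_urpath => //; exists emb; split=> // a b aN bN.
  by rewrite FE.
rewrite mem_filter; apply/andP; split; last first.
  apply/flattenP; exists (graphs N); last exact: graphs_filter.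
  by apply/mapP; exists (size ys) => //; rewrite mem_iota.
apply/andP; split.
  rewrite /pg_wf; apply/andP; split; last by [].
  apply/allP => -[a b]; rewrite mem_filter mem_all_pairs /t => /and3P[h aN bN].
  apply/and3P; split=> //.
  by apply: contraTneq h => ->; rewrite irr.
have frN : nfr K M <= N by apply: leq_addr.
apply/asboolP; split.
  split=> // a b; rewrite !inE /= => aN bN; rewrite FE ?inE /=; try lia.
  by rewrite /emb aN bN fr_adj.
pose x i := nth x0 xs i.
have x_xs i : x i \in xs.
  case: (ltnP i 5) => h; first by rewrite /x mem_nth.
  by rewrite /x nth_default // /xs mem_head.
have rhoN i : nfr K M + index (x i) ys < N.
  by rewrite /N ltn_add2l index_mem ys_xs.
exists (fun i => index (x i) ys) => // H; apply: nogood; move: H; rewrite /pattern_good.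
have ex i : emb (nfr K M + index (x i) ys) = x i.
  by rewrite /emb ltnNge leq_addr /= addKn nth_index // ys_xs.
set l1 := fun i a => _; set l2 := fun i a => _; set l3 := fun i a => _.
set m1 := fun i a => _; set m2 := fun i a => _; set m3 := fun i a => _.
have -> : l1 = m1.
  apply: funext => i; apply: funext => a; rewrite /l1 /m1; case: ltnP => //= h.
  have ha := ltA _ h.
  rewrite FE ?inE /= ?ex ?rhoN //; last by apply: leq_trans frN.
  by rewrite /emb ha.
have -> : l2 = m2.
  by apply: funext => i; apply: funext => j; rewrite /l2 /m2 FE ?inE /= ?ex.
have -> // : l3 = m3.
apply: funext => i; apply: funext => j; rewrite /l3 /m3.
apply/eqP/eqP => [|e]; last by rewrite /x e.
by move/(congr1 (nth x0 ys)); rewrite !nth_index ?ys_xs.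
Qed.

End Extract.

(** * From a free realization to a halting run *)

Lemma nextc_mod M i : nextc M (i %% M) = i.+1 %% M.
Proof. by rewrite /nextc -addn1 modnDml addn1. Qed.

Lemma anc_lt K M p c : p < npaths K -> c < M -> anc M p c < nanc K M.
Proof.
move=> pn cM; rewrite /anc /nanc -addnA ltn_add2l.
apply: leq_trans (_ : p.+1 * M <= _); first by rewrite mulSn addnC ltn_add2r.
by rewrite leq_mul2r pn orbT.
Qed.

Lemma anc_inj M p c p' c' : c < M -> c' < M -> anc M p c = anc M p' c' -> p = p' /\ c = c'.
Proof.
move=> cM cM'; rewrite /anc -!addnA => /addnI e.
have e1 := congr1 (divn^~ M) e; have e2 := congr1 (modn^~ M) e.
move: e1 e2; rewrite /= !modnMDl !modn_small // !divnMDl; try lia.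
by rewrite !divn_small // !addn0.
Qed.

(** The common ground of the realizations in both parts: [el p i] is vertex [i] of path [p]. The
    lengths and the edges between different paths stay open, as a realization may choose them. *)
Record skeleton (K M n : nat) (adj : rel 'I_n) (fr : nat -> 'I_n)
    (el : nat -> nat -> 'I_n) (len : nat -> nat) : Prop := Skeleton {
  sk_fr_inj : {in gtn (nfr K M) &, injective fr};
  sk_fr_adj : {in gtn (nfr K M) &, forall a b, adj (fr a) (fr b) = fedge K M a b};
  sk_fr_el : forall a p i, a < nfr K M -> p < npaths K -> i < len p -> fr a != el p i;
  sk_el_inj : forall p i j, p < npaths K -> i < len p -> j < len p ->
    el p i = el p j -> i = j;
  sk_len : forall p, p < npaths K -> 0 < len p;
  sk_start : forall p i, p < npaths K -> i < len p -> adj (fr 0) (el p i) = (i == 0);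
  sk_stop : forall p i, p < npaths K -> i < len p -> adj (fr 1) (el p i) = (i == (len p).-1);
  sk_col : forall p i p' c, p < npaths K -> i < len p -> p' < npaths K -> c < M ->
    adj (fr (anc M p' c)) (el p i) -> p' = p;
  sk_pc : forall c, c < M -> exists2 i, i < len (pPC K) & adj (fr (anc M (pPC K) c)) (el (pPC K) i);
  sk_next : forall p i, p < npaths K -> i.+1 < len p -> adj (el p i) (el p i.+1)
}.

Section Run.
Variables (P : seq instr) (K M n : nat) (adj : rel 'I_n).
Variables (fr : nat -> 'I_n) (el : nat -> nat -> 'I_n) (len : nat -> nat).
Hypothesis K0 : 0 < K.
Hypothesis M3 : 2 < M.
Hypothesis Pb : all (instr_bounded K M) P.
Hypothesis adjG : simple_graph adj.
Hypothesis sk : skeleton K M adj fr el len.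
Hypothesis free : forall F, F \in bad_patterns P K M -> ~ contains_pg adj F.

Let np := npaths K.
Definition colored p c x := [&& p < np, c < M & adj (fr (anc M p c)) x].
Definition elem x := exists p i, [/\ p < np, i < len p & x = el p i].

Let sym : symmetric adj. Proof. by case: adjG. Qed.

Definition rlab (xs : seq 'I_n) x0 i a := (a < nanc K M) && adj (fr a) (nth x0 xs i).

Lemma col_rlab xs x0 i p c : col K M (rlab xs x0) i p c = colored p c (nth x0 xs i).
Proof.
rewrite /col /colored /rlab /np; case pn : (p < _) => //=; case cM : (c < M) => //=.
by rewrite anc_lt.
Qed.

Lemma lab_rlab xs x0 i a : a < 3 -> rlab xs x0 i a = adj (fr a) (nth x0 xs i).
Proof. by rewrite /rlab /nanc => a3; rewrite (leq_trans a3) // leq_addr. Qed.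

Lemma elem_good x0 x1 x2 x3 x4 :
  elem x0 -> elem x1 -> elem x2 -> elem x3 -> elem x4 ->
  let xs := [:: x0; x1; x2; x3; x4] in
  good P K M (rlab xs x0)
       (fun i j => adj (nth x0 xs i) (nth x0 xs j))
       (fun i j => nth x0 xs i == nth x0 xs j).
Proof.
move=> h0 h1 h2 h3 h4 xs.
apply: (free_good adjG (sk_fr_inj sk) (sk_fr_adj sk) free) => a x an.
by rewrite !inE => /or4P[||| /orP[]] /eqP ->;
  [case: h0|case: h1|case: h2|case: h3|case: h4] => p [i [pn il ->]]; apply: (sk_fr_el sk).
Qed.

Lemma elem_el p i : p < np -> i < len p -> elem (el p i).
Proof. by move=> pn il; exists p, i. Qed.

Lemma colored_el p i : p < np -> i < len p -> colored p (i %% M) (el p i).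
Proof.
move=> pn.
have has_col j : j < len p -> exists c, colored p c (el p j).
  move=> jl; have E := elem_el pn jl.
  have [p' [c]] := good_col (elem_good E E E E E); rewrite col_rlab /= => h.
  have /and3P[pn' cM hc] := h; have e := sk_col sk pn jl pn' cM hc.
  by exists c; rewrite e in h.
(* Two consecutive colours are carried along, since [good_next] derives a colour from the two
   preceding ones. *)
suff H : i < len p -> colored p (i %% M) (el p i) /\
    (i.+1 < len p -> colored p (i.+1 %% M) (el p i.+1)) by move/H => -[].
elim: i => [|i IH] il.
  have E := elem_el pn il.
  have [c hc] := has_col 0 il.
  have S0 : adj (fr 0) (el p 0) by rewrite (sk_start sk).
  have c0 : colored p 0 (el p 0).
    have := good_start0 (elem_good E E E E E) (p := p) (c := c).
    by rewrite !col_rlab lab_rlab //=; apply.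
  rewrite mod0n; split=> // il1; have E1 := elem_el pn il1.
  have [c' hc'] := has_col 1 il1.
  have := good_start1 (elem_good E E1 E E E) (p := p) (c := c').
  by rewrite !col_rlab lab_rlab //=; apply => //; apply: (sk_next sk).
have [ci cS] := IH (ltnW il); split; first exact: cS.
move=> il2; have [c hc] := has_col _ il2.
have E := elem_el pn (ltnW il); have E1 := elem_el pn il; have E2 := elem_el pn il2.
have := good_next (elem_good E E1 E2 E E) (p := p) (c := i %% M) (d := c).
rewrite !col_rlab /= !nextc_mod; apply => //.
- exact: cS.
- exact: (sk_next sk).
- exact: (sk_next sk).
- by apply/eqP => /(sk_el_inj sk pn (ltnW (ltnW il2)) il2); lia.
Qed.

Lemma colored_el0 p : p < np -> colored p 0 (el p 0).
Proof. by move=> pn; have := colored_el pn (sk_len sk pn); rewrite mod0n. Qed.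

Lemma colored_uniq p i p' c : p < np -> i < len p -> colored p' c (el p i) ->
  p' = p /\ c = i %% M.
Proof.
move=> pn il cx; have E := elem_el pn il.
have := good_col_uniq (elem_good E E E E E) (p := p') (c := c).
by move=> /(_ p (i %% M)); rewrite !col_rlab /=; apply=> //; apply: colored_el.
Qed.

Let iT : pT < np. Proof. by []. Qed.
Let iI : pI K < np. Proof. by rewrite /np /npaths /pI. Qed.
Let iPC : pPC K < np. Proof. by rewrite /np /npaths /pPC. Qed.
Let iR r : r < K -> pR r < np. Proof. by rewrite /np /npaths /pR; lia. Qed.

(** Keeps a register path of unknown length from ending too early. *)
Lemma room p i r v : p = pI K \/ p = pT -> i < len p -> r < K -> v < len (pR r) ->
  adj (el p i) (el (pR r) v) -> v.+1 < len (pR r).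
Proof.
move=> hp il rK vl a.
have pn : p < np by case: hp => ->.
have := good_room (elem_good (elem_el pn il) (elem_el (iR rK) vl) (elem_el pn il)
  (elem_el pn il) (elem_el pn il)) hp rK.
move=> /(_ (i %% M) (v %% M)); rewrite !col_rlab lab_rlab //=.
move=> /(_ (colored_el pn il) (colored_el (iR rK) vl) a).
by rewrite (sk_stop sk) //; [move/eqP; lia|apply: iR].
Qed.

(** The edge between the two first vertices is forced, and each diagonal edge forces the next one,
    [room] supplying the next register vertex. This carries the position of the mark over to
    register 0. *)
Lemma input_diag i : i < len (pI K) -> i < len (pR 0) /\ adj (el (pI K) i) (el (pR 0) i).
Proof.
have iR0 := iR K0.
elim: i => [|i IH] il.
  have l0 := sk_len sk iR0; split=> //.
  have E := elem_el iI il; have E1 := elem_el iR0 l0.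
  have := good_diag0 (elem_good E E1 E E E).
  rewrite !col_rlab !lab_rlab //= !(sk_start sk) //.
  by apply=> //; apply: colored_el0.
have il' := ltnW il; have [vl a] := IH il'.
have vl1 := room (or_introl erefl) (ltnW il) K0 vl a; split=> //.
have E := elem_el iI (ltnW il); have E1 := elem_el iI il.
have E2 := elem_el iR0 vl; have E3 := elem_el iR0 vl1.
have := good_diag (elem_good E E1 E2 E3 E) (c := i %% M).
rewrite !col_rlab /= nextc_mod; apply=> //; try exact: colored_el; exact: (sk_next sk).
Qed.

(** Further neighbours of the time step are allowed. The vertices with the colour of the program
    counter sit at unknown places and may be many, hence the quantification over all of them. *)
Definition simulates t (x : nat * regs) : Prop :=
  [/\ x.1 < M,
      forall i, i < len (pPC K) -> colored (pPC K) x.1 (el (pPC K) i) ->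
        adj (el pT t) (el (pPC K) i) &
      forall r, r < K -> x.2 r < len (pR r) /\ adj (el pT t) (el (pR r) (x.2 r))].

Lemma simulates_init i : i < len (pI K) -> adj (fr 2) (el (pI K) i) ->
  simulates 0 (cm_init i).
Proof.
move=> il mk; have t0 := sk_len sk iT; have E := elem_el iT t0.
have cT : colored pT 0 (el pT 0) by apply: colored_el0.
split=> /=; first by lia.
  move=> j jl cj.
  have := good_init_pc (elem_good E (elem_el iPC jl) E E E).
  by rewrite !col_rlab lab_rlab //= (sk_start sk) //; apply.
move=> [|r] rK.
  rewrite upd_same; have [vl a] := input_diag il; split=> //.
  have := good_init_input (elem_good E (elem_el iI il) (elem_el (iR rK) vl) E E)
    (c := i %% M) (d := i %% M).
  rewrite !col_rlab !lab_rlab //= (sk_start sk) //; apply=> //; exact: colored_el.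
rewrite upd_other //=; have l0 := sk_len sk (iR rK); split=> //.
have := good_init_reg (elem_good E (elem_el (iR rK) l0) E E E) (r := r.+1) rK.
rewrite !col_rlab !lab_rlab //= !(sk_start sk) //; last exact: iR.
by apply=> //; apply: colored_el0; apply: iR.
Qed.

Lemma simulates_step t x : t.+1 < len pT -> x.1 < size P ->
  simulates t x -> simulates t.+1 (cm_step P x).
Proof.
case: x => q s tl qP [/= qM Hpc Hr].
have tl' := ltnW tl; have Et := elem_el iT tl'; have Et' := elem_el iT tl.
have ct := colored_el iT tl'; have ct' := colored_el iT tl.
have at_ := sk_next sk iT tl.
have [ix ixl cx'] := sk_pc sk qM; have Ex := elem_el iPC ixl.
have cx : colored (pPC K) q (el (pPC K) ix) by rewrite /colored iPC qM.
have ax := Hpc _ ixl cx.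
have frame r : r < K -> r <> instr_reg (nth (INC 0 0) P q) ->
    adj (el pT t.+1) (el (pR r) (s r)).
  move=> rK ne; have [vl a] := Hr r rK.
  have := good_frame (elem_good Et Et' Ex (elem_el (iR rK) vl) Et)
    (c := t %% M) (q := q) (r := r) (d := s r %% M) qP.
  by rewrite !col_rlab /= nextc_mod; apply=> //; apply: colored_el => //; apply: iR.
have step x3 x4 (E3 : elem x3) (E4 : elem x4) :=
  good_step (elem_good Et Et' Ex E3 E4) (c := t %% M) (q := q) qP.
have := all_nthP (INC 0 0) Pb _ qP; rewrite /cm_step qP /=.
case: (nth (INC 0 0) P q) frame step => [r j|r j k] frame step /=.
  move=> /andP[rK jM]; have [vl a] := Hr r rK.
  have vl1 := room (or_intror erefl) tl' rK vl a.
  split=> //=.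
    move=> i il ci; have := step _ _ (elem_el iPC il) Et.
    by rewrite !col_rlab /= nextc_mod => /(_ ct ct' at_ cx ax)[] /(_ ci).
  move=> r' rK'; rewrite /upd; case: eqP => [->|ne]; last first.
    by split; [case: (Hr r' rK')|apply: frame].
  split=> //; have := step _ _ (elem_el (iR rK) vl) (elem_el (iR rK) vl1).
  rewrite !col_rlab /= nextc_mod => /(_ ct ct' at_ cx ax)[_] /(_ (s r %% M)).
  rewrite !col_rlab /= nextc_mod; apply=> //.
  - by apply: colored_el => //; apply: iR.
  - by apply: colored_el => //; apply: iR.
  - by apply: (sk_next sk) => //; apply: iR.
move=> /and3P[rK jM kM]; have [vl a] := Hr r rK.
have cy := colored_el (iR rK) vl; have Ey := elem_el (iR rK) vl.
case sr : (s r) => [|y]; rewrite sr in vl a cy Ey.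
  split=> //= [i il ci|r' rK'].
    have := step _ _ Ey (elem_el iPC il).
    rewrite !col_rlab /= nextc_mod => /(_ ct ct' at_ cx ax (0 %% M)).
    rewrite !col_rlab lab_rlab //= (sk_start sk) //; last exact: iR.
    by move=> /(_ cy a)[_]; apply.
  have [e|ne] := eqVneq r' r; last by split; [case: (Hr r' rK')|apply: frame => //; apply/eqP].
  rewrite e sr; split=> //.
  have := step _ _ Ey Et.
  rewrite !col_rlab /= nextc_mod => /(_ ct ct' at_ cx ax (0 %% M)).
  rewrite !col_rlab lab_rlab //= (sk_start sk) //; last exact: iR.
  by move=> /(_ cy a)[].
split=> //= [i il ci|r' rK'].
  have := step _ _ Ey (elem_el iPC il).
  rewrite !col_rlab /= nextc_mod => /(_ ct ct' at_ cx ax (y.+1 %% M)).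
  rewrite !col_rlab lab_rlab //= (sk_start sk) //; last exact: iR.
  by move=> /(_ cy a)[+ _]; apply.
rewrite /upd; case: eqP => [->|ne]; last by split; [case: (Hr r' rK')|apply: frame].
have vl1 := ltnW vl; split=> //.
have := step _ _ Ey (elem_el (iR rK) vl1).
rewrite !col_rlab /= nextc_mod => /(_ ct ct' at_ cx ax (y.+1 %% M)).
rewrite !col_rlab lab_rlab //= (sk_start sk) //; last exact: iR.
move=> /(_ cy a)[_] /(_ (y %% M)); rewrite col_rlab /= nextc_mod; apply=> //.
- by apply: colored_el => //; apply: iR.
- by rewrite sym; apply: (sk_next sk) => //; apply: iR.
Qed.

(** If the run never halted, the invariant would persist up to the last time step, which would then
    see a vertex of a nonhalting program counter, against [good_final]. *)
Lemma skeleton_halts i : i < len (pI K) -> adj (fr 2) (el (pI K) i) -> cm_halts P i.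
Proof.
move=> il mk; apply: contrapT => nh.
have lt_t t : (cm_run P t (cm_init i)).1 < size P.
  by rewrite ltnNge; apply/negP => h; apply: nh; exists t.
have sim t : t < len pT -> simulates t (cm_run P t (cm_init i)).
  elim: t => [|t IH] tl; first exact: simulates_init.
  by apply: simulates_step => //; [apply: lt_t|apply: IH; apply: ltnW].
have l0 := sk_len sk iT; pose t := (len pT).-1.
have tl : t < len pT by rewrite /t; lia.
have [qM Hpc _] := sim t tl.
have [ix ixl cx'] := sk_pc sk qM.
have cx : colored (pPC K) (cm_run P t (cm_init i)).1 (el (pPC K) ix) by rewrite /colored iPC qM.
have ax := Hpc _ ixl cx.
have E := elem_el iT tl; have Ex := elem_el iPC ixl.
have := good_final (elem_good E Ex E E E) (c := t %% M).
move=> /(_ (cm_run P t (cm_init i)).1).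
rewrite !col_rlab lab_rlab //= (sk_stop sk) // eqxx lt_t ax => H.
by have := H isT (colored_el iT tl) isT cx.
Qed.

End Run.

(** * The graph of a halting run *)

Lemma mod_neq2 M i : 2 < M -> (i.+2 %% M == i %% M) = false.
Proof. by move=> M3; rewrite -addn2 -{2}(addn0 i) eqn_modDl mod0n modn_small. Qed.

Lemma mod_neq1 M i : 1 < M -> (i.+1 %% M == i %% M) = false.
Proof. by move=> M2; rewrite -addn1 -{2}(addn0 i) eqn_modDl mod0n modn_small. Qed.

Section Construct.
Variables (P : seq instr) (K M n tau : nat).
Hypothesis M3 : 2 < M.

(** Long enough for every colour to occur, for the time to reach [tau], and for all register values
    and all input positions to stay below the last position of a register path. *)
Definition bound := n + tau + M + 3.
(** The input path has the length fixed by [input_pg], so that one graph serves both parts. The [M]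
    vertices after the mark keep the mark off the end and make every colour occur. *)
Definition plen (p : nat) : nat := if p == pI K then n + M + 1 else bound.
Definition conf (t : nat) : nat * regs := cm_run P t (cm_init n).

Definition vlab (a : nat) (x : nat * nat) : bool :=
  [|| (a == 0) && (x.2 == 0), (a == 1) && (x.2 == (plen x.1).-1),
      [&& a == 2, x.1 == pI K & x.2 == n] | a == anc M x.1 (x.2 %% M)].

Definition rung (x y : nat * nat) : bool :=
  [|| [&& x.1 == pT, y.1 == pPC K & (conf x.2).1 == y.2 %% M],
      [&& x.1 == pT, 0 < y.1 <= K & (conf x.2).2 y.1.-1 == y.2] |
      [&& x.1 == pI K, y.1 == pR 0 & x.2 == y.2]].

Definition eadj (x y : nat * nat) : bool :=
  if x.1 == y.1 then (x.2.+1 == y.2) || (y.2.+1 == x.2) else rung x y || rung y x.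

Definition valid (x : nat * nat) : bool := (x.1 < npaths K) && (x.2 < plen x.1).

Lemma eadj_sym x y : eadj x y = eadj y x.
Proof. by rewrite /eadj eq_sym; case: eqP => _; rewrite orbC. Qed.

(** With at least three colours, the predecessor of a vertex never has the colour that its successor
    must have. *)
Lemma eadj_next p i j : eadj (p, i) (p, j) -> j %% M = nextc M (i %% M) -> j = i.+1.
Proof.
rewrite /eadj eqxx nextc_mod /= => /orP[/eqP //|/eqP <-] /esym /eqP.
by rewrite mod_neq2.
Qed.

Hypothesis K0 : 0 < K.
Hypothesis Pb : all (instr_bounded K M) P.
Hypothesis halted : size P <= (cm_run P tau (cm_init n)).1.

Lemma confS t : conf t.+1 = cm_step P (conf t).
Proof. by []. Qed.

Lemma conf_late t : tau <= t -> conf t = conf tau.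
Proof. by move=> h; rewrite /conf -(subnKC h) cm_run_add cm_run_halted. Qed.

(** A step raises a register by at most one, and nothing changes after [tau]. *)
Lemma conf_reg t r : (conf t).2 r <= n + tau.
Proof.
have H u : (conf u).2 r <= n + u.
  elim: u => [|u]; first by rewrite /= /upd; case: eqP; lia.
  rewrite confS /cm_step; case: ifP => _; last by lia.
  case: nth => [r' j|r' j k] /=; first by regs_case.
  by case e : ((conf u).2 r') => [|y] /=; [lia|regs_case].
by case: (leqP tau t) => h; [rewrite conf_late ?H|have := H t; lia].
Qed.

Section RunElements.
Variable x : nat -> nat * nat.
Hypothesis xv : forall i, valid (x i).

Definition xlab i a := (a < nanc K M) && vlab a (x i).

Lemma xlab0 i : xlab i 0 = ((x i).2 == 0).
Proof. by rewrite /xlab /vlab /nanc /anc /= !orbF. Qed.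
Lemma xlab1 i : xlab i 1 = ((x i).2 == (plen (x i).1).-1).
Proof. by rewrite /xlab /vlab /nanc /anc /= !orbF. Qed.
Lemma xlab2 i : xlab i 2 = ((x i).1 == pI K) && ((x i).2 == n).
Proof. by rewrite /xlab /vlab /nanc /anc /= !orbF. Qed.
Lemma xcol i p c : col K M xlab i p c = (p == (x i).1) && (c == (x i).2 %% M).
Proof.
have M0 : 0 < M by lia.
have /andP[xn _] := xv i.
apply/idP/andP => [/and3P[pn cM]|[/eqP -> /eqP ->]]; last first.
  have h : (x i).2 %% M < M by rewrite ltn_mod.
  by rewrite /col xn h /xlab anc_lt //= /vlab eqxx !orbT.
rewrite /xlab anc_lt //= /vlab => /or4P[/andP[]|/andP[]|/andP[]|/eqP] //.
by case/anc_inj; rewrite ?ltn_mod // => -> ->.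
Qed.

Lemma plen_bound p : p != pI K -> plen p = bound.
Proof. by rewrite /plen => /negPf ->. Qed.

(** A colour determines the path of an element, and adjacency together with the next colour
    determines its successor. Each rule thus turns into arithmetic on positions and the definition
    of one machine step. *)
Lemma construct_good :
  good P K M xlab (fun i j => eadj (x i) (x j)) (fun i j => x i == x j).
Proof.
have E i p c : col K M xlab i p c -> exists k, [/\ x i = (p, k), c = k %% M & k < plen p].
  rewrite xcol => /andP[/eqP -> /eqP ->]; exists (x i).2; split=> //.
    by rewrite -surjective_pairing.
  by have /andP[] := xv i.
have S i p k : x i = (p, k) -> (xlab i 0 -> k = 0) /\ (xlab i 1 -> k = (plen p).-1).
  by move=> e; rewrite xlab0 xlab1 e; split=> /eqP.
have PT : plen pT = bound by rewrite plen_bound.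
have PR r : r < K -> plen (pR r) = bound by rewrite /pR => rK; rewrite plen_bound // /pI; lia.
have TPC i j : eadj (pT, i) (pPC K, j) = ((conf i).1 == j %% M).
  by rewrite /eadj /rung /= /pPC ltnn eqxx andbF !orbF.
have TR i r j : r < K -> eadj (pT, i) (pR r, j) = ((conf i).2 r == j).
  move=> rK; rewrite /eadj /rung /= /pPC /pR !orbF eqSS (ltn_eqF rK) /= rK.
  by rewrite andbF orbF.
have IRr i r j : r < K -> eadj (pI K, i) (pR r, j) = (r == 0) && (i == j).
  move=> rK; rewrite /eadj /rung /= /pPC /pR /pI /pT !eqSS /=.
  by rewrite (_ : (K.+1 == r) = false) ?eqxx ?orbF //=; lia.
have IR i j : eadj (pI K, i) (pR 0, j) = (i == j) by rewrite IRr.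
split.
- exists (x 0).1, ((x 0).2 %% M); by rewrite xcol !eqxx.
- by move=> p c p' c'; rewrite !xcol => /andP[/eqP -> /eqP ->] /andP[/eqP -> /eqP ->].
- by move=> p c; rewrite xlab0 !xcol => /eqP e /andP[-> _]; rewrite e mod0n.
- move=> p c; rewrite xlab0 => /eqP x00 /E[k [e0 _ _]] /E[j [e1 _ _]].
  move: x00; rewrite xcol e0 e1 /= => ->; rewrite /eadj eqxx /= => /orP[/eqP <-|//].
  by rewrite /nextc !eqxx.
- move=> p c d /E[i0 [-> -> _]] /E[i1 [e1 h1 _]] /E[i2 [e2 _ _]].
  rewrite xcol e1 e2 => a01; have := eadj_next a01 (esym h1) => e; subst i1.
  rewrite /eadj eqxx /= => /orP[/eqP <- _|/eqP [->]]; last by rewrite eqxx.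
  by rewrite !nextc_mod !eqxx.
- rewrite xlab1 xlab2 => /andP[/eqP -> /eqP ->].
  by rewrite /plen eqxx; apply/eqP; lia.
- rewrite !xlab0 => /eqP h0 /E[i0 [e0 _ _]] /eqP h1 /E[i1 [e1 _ _]].
  by rewrite e0 e1 IR; move: h0 h1; rewrite e0 e1 /= => -> ->.
- move=> c /E[i0 [-> -> _]] /E[i1 [-> h1 _]] a01 /E[i2 [-> _ _]] /E[i3 [-> h3 _]] a23.
  rewrite !IR => /eqP e; subst i2.
  by rewrite (eadj_next a01 (esym h1)) (eadj_next a23 (esym h3)).
- move=> p r c d hp rK /E[i0 [-> _ l0]] /E[i1 [e1 _ _]].
  rewrite xlab1 e1 PR //=; case: hp => hp; subst p.
    rewrite IRr // => /andP[_ /eqP <-]; rewrite /plen eqxx in l0.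
    by apply/eqP; rewrite /bound; lia.
  rewrite TR // => /eqP <-; have := conf_reg i0 r; rewrite /bound => ?.
  by apply/eqP; lia.
- move=> c d; rewrite xlab0 xlab2 => /eqP h0 /E[i0 [e0 _ _]] /andP[_ /eqP h1].
  move=> /E[i1 [e1 _ _]] /E[i2 [-> _ _]]; move: h0 h1; rewrite e0 e1 /= => -> ->.
  by rewrite IR TR // => /eqP <-; rewrite /= upd_same.
- move=> r /andP[r0 rK]; rewrite !xlab0 => /eqP h0 /E[i0 [e0 _ _]] /eqP h1 /E[i1 [e1 _ _]].
  move: h0 h1; rewrite e0 e1 /= => -> ->; rewrite TR // /= upd_other //; lia.
- rewrite xlab0 => /eqP h0 /E[i0 [e0 _ _]] /E[i1 [-> h1 _]].
  by move: h0; rewrite e0 /= TPC -h1 => ->.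
- move=> c q; rewrite xlab1 => /eqP h0 /E[i0 [e0 _ _]] qP /E[i1 [-> hq _]].
  move: h0; rewrite e0 /= PT TPC -hq => ->; rewrite conf_late; last by rewrite /bound; lia.
  by apply/eqP => e; move: halted; rewrite -/(conf tau) e; lia.
- move=> c q r d qP /E[i0 [-> -> _]] /E[i1 [-> h1 _]] a01.
  rewrite (eadj_next a01 (esym h1)) => /E[i2 [-> hq _]] + rK ne /E[i3 [-> _ _]].
  rewrite TPC !TR // -hq => /eqP eq_; rewrite confS /cm_step eq_ qP.
  case: (nth (INC 0 0) P q) ne => [r' j|r' j k] /= ne; first by regs_case.
  by case: ((conf i0).2 r') => [|y] //=; regs_case.
- move=> c q qP /E[i0 [-> -> _]] /E[i1 [-> h1 _]] a01.
  rewrite (eadj_next a01 (esym h1)) => /E[i2 [-> hq _]]; rewrite TPC -hq => /eqP eq_.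
  have := confS i0; have TPC' j : eadj (pT, i0.+1) (pPC K, j) = ((conf i0.+1).1 == j %% M).
    exact: TPC.
  have TR' r j : r < K -> eadj (pT, i0.+1) (pR r, j) = ((conf i0.+1).2 r == j).
    exact: TR.
  move: (conf i0.+1) TPC' TR' => cn TPC' TR'; rewrite /cm_step eq_ qP.
  have := all_nthP (INC 0 0) Pb _ qP.
  case: (nth (INC 0 0) P q) => [r j|r j k] /=.
    move=> /andP[rK jM] cS; split; first by move=> /E[i3 [-> h3 _]]; rewrite TPC' cS -h3 eqxx.
    move=> d /E[i3 [-> -> _]] /E[i4 [-> h4 _]] a34; rewrite TR // TR' // cS /= upd_same.
    by rewrite (eadj_next a34 (esym h4)) eqSS.
  move=> /and3P[rK jM kM] cS d /E[i3 [e3 -> _]]; rewrite xlab0 e3 TR // => /eqP h3.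
  rewrite h3 /= in cS *; case: eqP => [i30|i30].
    subst i3; rewrite i30 in cS *; rewrite TR' // cS /=; split; first by rewrite i30.
    by move=> /E[i4 [-> h4 _]]; rewrite TPC' cS -h4 eqxx.
  case: i3 e3 h3 i30 cS => // y e3 h3 _ cS; split.
    by move=> /E[i4 [-> h4 _]]; rewrite TPC' cS -h4 eqxx.
  move=> d' h /E[i4 [-> hd' _]]; rewrite eadj_sym => a34; subst d'.
  have [e] := eadj_next a34 h; subst i4.
  by rewrite TR' // cS /= upd_same.
Qed.

End RunElements.
End Construct.

(** * Rigidity of the frame *)

Lemma count_ltn_iota a n : count (fun i => i < a) (iota 0 n) = minn a n.
Proof.
elim: n => [|n IH]; first by rewrite minn0.
by rewrite -addn1 iotaD count_cat IH /= add0n; lia.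
Qed.

Section Rigid.
Variables (P : seq instr) (K M n tau : nat).
Hypothesis M3 : 2 < M.

Notation vlab := (vlab K M n tau).
Notation eadj := (eadj P K M n).
Notation valid := (valid K M n tau).
Notation nanc := (nanc K M).
Notation nfr := (nfr K M).
Notation nclq := (nclq K M).
Notation fedge := (fedge K M).

Definition vadj (u v : nat + nat * nat) : bool :=
  match u, v with
  | inl a, inl b => fedge a b
  | inl a, inr x => vlab a x
  | inr x, inl a => vlab a x
  | inr x, inr y => eadj x y
  end.

Definition vvalid (u : nat + nat * nat) : bool :=
  match u with inl a => a < nfr | inr x => valid x end.

Lemma anc_valid x : valid x -> anc M x.1 (x.2 %% M) < nanc.
Proof. by move=> /andP[xn _]; apply: anc_lt => //; rewrite ltn_mod; lia. Qed.

Lemma vlab_clique a x : nanc <= a -> valid x -> vlab a x = false.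
Proof.
move=> na /anc_valid; rewrite /vlab => h.
have a3 : 2 < a by apply: leq_trans na; rewrite /nanc; lia.
apply/negbTE/negP => /or4P[/andP[/eqP]|/andP[/eqP]|/and3P[/eqP]|/eqP]; lia.
Qed.

Lemma vadj_sym u v : vadj u v = vadj v u.
Proof.
case: u v => [a|x] [b|y] //=; last exact: eadj_sym.
by rewrite /fedge; apply/or3P/or3P => -[] /and3P[h1 h2 h3];
  do ?[by apply: Or31; apply/and3P; split=> //; rewrite eq_sym
      |by apply: Or33; apply/and3P|by apply: Or32; apply/and3P].
Qed.

Section Embedding.
Variable h : nat -> nat + nat * nat.
Hypothesis hv : forall a, a < nfr -> vvalid (h a).
Hypothesis hi : {in gtn nfr &, injective h}.
Hypothesis ha : {in gtn nfr &, forall a b, vadj (h a) (h b) = fedge a b}.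

Definition in_clique (u : nat + nat * nat) : bool := if u is inl a then nanc <= a else false.

(* Injective and small on every clique that leaves the frame clique. *)
Definition clique_rank (u : nat + nat * nat) : nat :=
  match u with
  | inr x => anc M x.1 (x.2 %% M)
  | inl a => if a < nanc then nanc else a - nanc
  end.

Lemma eadj_anc x y : eadj x y -> anc M x.1 (x.2 %% M) <> anc M y.1 (y.2 %% M).
Proof.
case: x y => p i [q j] /= + e; have M0 : 0 < M by lia.
have [] := anc_inj _ _ e; rewrite ?ltn_mod // => -> em.
have M1 : 1 < M by lia.
rewrite /eadj eqxx /= => /orP[] /eqP h'; move/eqP: em; rewrite -h'.
  by rewrite eq_sym mod_neq1.
by rewrite mod_neq1.
Qed.

Lemma clique_rank_inj u v : vvalid u -> vvalid v -> vadj u v -> clique_rank u <> clique_rank v.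
Proof.
case: u v => [a|x] [b|y] /= uv vv.
- by rewrite /fedge => /or3P[] /and3P[h1 h2 h3]; case: ltnP => ?; case: ltnP => ?; lia.
- case: ltnP => h1; last by rewrite vlab_clique.
  by have := anc_valid vv; lia.
- case: ltnP => h1; last by rewrite vlab_clique.
  by have := anc_valid uv; lia.
- exact: eadj_anc.
Qed.

(** If one image left the frame clique, the images of all [nclq] clique vertices would have distinct
    ranks among the [nanc + 1] values up to [nanc], which are too few. *)
Lemma embedding_clique j : nanc <= j < nfr -> in_clique (h j).
Proof.
move=> /andP[nj jn]; apply: contraT => nc.
pose s := iota nanc nclq.
have sP i : (i \in s) = (nanc <= i < nfr) by rewrite mem_iota.
have adj i k : i \in s -> k \in s -> i != k -> vadj (h i) (h k).
  rewrite !sP => /andP[i1 i2] /andP[k1 k2] ik.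
  by rewrite ha ?inE //= /fedge i1 k1 ik.
have u : uniq [seq clique_rank (h i) | i <- s].
  rewrite map_inj_in_uniq ?iota_uniq // => i k si sk e.
  apply/eqP; apply: contraT => ik; move: (si) (sk); rewrite !sP => /andP[_ i2] /andP[_ k2].
  by have := clique_rank_inj (hv i2) (hv k2) (adj _ _ si sk ik); rewrite e.
have sub : {subset [seq clique_rank (h i) | i <- s] <= iota 0 nanc.+1}.
  move=> _ /mapP[i si ->]; rewrite mem_iota add0n /=.
  move: (si); rewrite sP => /andP[i1 i2]; have := hv i2.
  case hi_ : (h i) => [a|x] /= va; last by apply: leqW; apply: anc_valid.
  case: (ltnP a nanc) => // na.
  have ij : i != j by apply/eqP => e; move: nc; rewrite -e hi_ /= na.
  have sj : j \in s by rewrite sP nj.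
  have := adj _ _ si sj ij; rewrite hi_ /=.
  have := hv jn; case: (h j) nc => [b|y] /= nc vb; last by rewrite vlab_clique.
  by rewrite /fedge => /or3P[] /and3P[]; lia.
by have := uniq_leq_size u sub; rewrite size_map !size_iota /nclq; lia.
Qed.

Definition inl_val (u : nat + nat * nat) : nat := if u is inl a then a else 0.

(** The clique is fixed only as a set: its last two vertices see no anchor and may be exchanged. *)
Lemma embedding_clique_perm :
  perm_eq [seq inl_val (h j) | j <- iota nanc nclq] (iota nanc nclq).
Proof.
have H j : j \in iota nanc nclq -> nanc <= inl_val (h j) < nfr /\ h j = inl (inl_val (h j)).
  rewrite mem_iota -/nfr => jn; have := embedding_clique jn; have /andP[_ /hv] := jn.
  by case: (h j) => //= a -> ->.
have u : uniq [seq inl_val (h j) | j <- iota nanc nclq].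
  rewrite map_inj_in_uniq ?iota_uniq // => i k si sk e.
  apply: hi; rewrite ?inE /=.
  - by move: si; rewrite mem_iota => /andP[].
  - by move: sk; rewrite mem_iota => /andP[].
  - by rewrite (H i si).2 (H k sk).2 e.
apply: uniq_perm (u) (iota_uniq _ _) _.
have [||_ //] := uniq_min_size u (s2 := iota nanc nclq).
  by move=> _ /mapP[j /H[h1 _] ->]; rewrite mem_iota.
by rewrite size_map.
Qed.

(** The number of neighbours in the clique identifies an anchor. Run elements have none there, and
    the clique vertices are already images of clique vertices. *)
Lemma embedding_anchor a : a < nanc -> h a = inl a.
Proof.
move=> an; have an' : a < nfr by rewrite /nfr; lia.
pose s := iota nanc nclq.
have E j : j \in s -> h j = inl (inl_val (h j)).
  by rewrite mem_iota => /embedding_clique; case: (h j).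
have cnt b : b < nanc -> count (fedge b) s = b.+1.
  move=> bn; rewrite /s -[nanc]addn0 iotaDl count_map.
  rewrite (eq_count (a2 := fun i => i < b.+1)) => [|i /=].
    by rewrite count_ltn_iota /nclq; lia.
  rewrite /fedge (ltnNge (nanc + i)) leq_addr addKn bn leqNgt bn /=.
  by rewrite ltnS /= orbF.
have c1 : count (fun k => vadj (h a) (inl k)) s = a.+1.
  rewrite -(permP embedding_clique_perm) count_map -(cnt a an).
  apply: eq_in_count => j sj /=; rewrite -(E j sj) ha ?inE //=.
  by move: sj; rewrite mem_iota => /andP[].
have vb := hv an'; case e : (h a) => [b|x]; rewrite e in vb c1; last first.
  move: c1; have -> : count (fun k => vadj (inr x) (inl k)) s = count pred0 s.
    by apply: eq_in_count => k; rewrite mem_iota => /andP[k1 _] /=; rewrite vlab_clique.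
  by rewrite count_pred0.
case: (ltnP b nanc) => bn; first by move: c1; rewrite cnt // => -[->].
have : b \in [seq inl_val (h j) | j <- s].
  by rewrite (perm_mem embedding_clique_perm) mem_iota bn.
move=> /mapP[j sj bj]; have := E j sj; rewrite -bj -e => ej.
have jn : nanc <= j < nfr by move: sj; rewrite mem_iota.
have : j = a by apply: hi => //; rewrite inE //=; case/andP: jn.
lia.
Qed.

End Embedding.
End Rigid.

(** * The run as a finite graph without bad patterns *)

Section RunGraph.
Variables (P : seq instr) (K M n tau : nat).
Hypothesis M3 : 2 < M.

Notation vlab := (vlab K M n tau).
Notation eadj := (eadj P K M n).
Notation valid := (valid K M n tau).
Notation vvalid := (vvalid K M n tau).
Notation vadj := (vadj P K M n tau).
Notation nanc := (nanc K M).
Notation nfr := (nfr K M).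
Notation fedge := (fedge K M).

Definition verts : seq (nat + nat * nat) :=
  undup ([seq inl a | a <- iota 0 nfr] ++
         [seq inr (p, i) | p <- iota 0 (npaths K), i <- iota 0 (plen K M n tau p)]).

Lemma mem_verts u : (u \in verts) = vvalid u.
Proof.
rewrite mem_undup mem_cat; case: u => [a|[p i]].
  rewrite mem_map; last by move=> ? ? [].
  rewrite mem_iota add0n [X in _ || X](_ : _ = false) ?orbF //.
  by apply/negbTE/negP => /allpairsPdep[p [i [_ _]]].
rewrite [X in X || _](_ : _ = false) ?orFb; last by apply/negbTE/negP => /mapP[].
apply/allpairsPdep/andP => [[p' [i' [hp hi [-> ->]]]]|[hp hi]].
  by move: hp hi; rewrite !mem_iota.
by exists p, i; rewrite !mem_iota.
Qed.

Lemma nfr_gt0 : 0 < nfr. Proof. by []. Qed.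

(* [size verts], in a form for which [inord] is available. *)
Definition nverts := (size verts).-1.+1.

Lemma nvertsE : nverts = size verts.
Proof.
have : inl 0 \in verts by rewrite mem_verts /= nfr_gt0.
by rewrite /nverts; case: verts.
Qed.

Definition of_vert (u : nat + nat * nat) : 'I_nverts := inord (index u verts).
Definition to_vert (i : 'I_nverts) : nat + nat * nat := nth (inl 0) verts i.
Definition run_graph : rel 'I_nverts := fun i j => vadj (to_vert i) (to_vert j).

Lemma of_vertK u : vvalid u -> to_vert (of_vert u) = u.
Proof.
rewrite -mem_verts => hu; rewrite /to_vert /of_vert inordK ?nth_index //.
by rewrite -/nverts nvertsE index_mem.
Qed.

Lemma to_vert_valid i : vvalid (to_vert i).
Proof. by rewrite -mem_verts mem_nth // -nvertsE. Qed.

Lemma to_vert_inj : injective to_vert.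
Proof.
move=> i j /eqP; rewrite nth_uniq ?undup_uniq -?nvertsE //.
by move=> /eqP e; apply: val_inj.
Qed.

Lemma to_vertK i : of_vert (to_vert i) = i.
Proof. by apply: to_vert_inj; rewrite of_vertK // to_vert_valid. Qed.

Lemma run_graph_simple : simple_graph run_graph.
Proof.
split=> [i j|i]; first exact: vadj_sym.
rewrite /run_graph; case: (to_vert i) => [a|x] /=.
  by rewrite /fedge eqxx !andbF /=; apply/negbTE/negP => /orP[] /and3P[]; lia.
by rewrite /eadj eqxx orbb; apply/negbTE/eqP; lia.
Qed.

(** By rigidity the frame of [F] uses up all frame vertices of the run graph, so the other vertices
    of [F] land on run elements and carry the labels of those elements. *)
Lemma run_graph_framed F : framed K M F -> contains_pg run_graph F ->
  exists x : nat -> nat * nat,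
    [/\ forall i, nfr + i < pg_nv F -> valid (x i),
        forall i j, nfr + i < pg_nv F -> nfr + j < pg_nv F -> x i = x j -> i = j,
        forall a i, a < nanc -> nfr + i < pg_nv F -> pg_edge F a (nfr + i) = vlab a (x i) &
        forall i j, nfr + i < pg_nv F -> nfr + j < pg_nv F ->
          pg_edge F (nfr + i) (nfr + j) = eadj (x i) (x j)].
Proof.
move=> [nu0 nvF frF] /contains_no_urpath[//|h0 [h0_inj h0_adj]].
pose h a := to_vert (h0 a).
have hv a : vvalid (h a) by apply: to_vert_valid.
have h_inj : {in gtn (pg_nv F) &, injective h}.
  by move=> a b aF bF /to_vert_inj; apply: h0_inj.
have h_adj : {in gtn (pg_nv F) &, forall a b, vadj (h a) (h b) = pg_edge F a b}.
  exact: h0_adj.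
have ltF a : a < nfr -> a < pg_nv F by move=> ?; apply: leq_trans nvF.
have hi' : {in gtn nfr &, injective h}.
  by move=> a b aF bF; apply: h_inj; apply: ltF.
have ha' : {in gtn nfr &, forall a b, vadj (h a) (h b) = fedge a b}.
  by move=> a b aF bF; rewrite -frF // h_adj //; apply: ltF.
have A := embedding_anchor M3 (fun a _ => hv a) hi' ha'.
have Q := embedding_clique M3 (fun a _ => hv a) ha'.
have S := embedding_clique_perm M3 (fun a _ => hv a) hi' ha'.
have nan a : a < nanc -> a < nfr by rewrite /nfr; lia.
have E i : nfr + i < pg_nv F -> exists x, h (nfr + i) = inr x.
  move=> iF; case e : (h (nfr + i)) => [a|x]; last by exists x.
  have va := hv (nfr + i); rewrite e /= in va.
  have [j jn ej] : exists2 j, j < nfr & h j = inl a.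
    case: (ltnP a nanc) => an; first by exists a; [apply: nan|apply: A].
    have : a \in [seq inl_val (h j) | j <- iota nanc (nclq K M)].
      by rewrite (perm_mem S) mem_iota an.
    move=> /mapP[j]; rewrite mem_iota => jn ->; exists j; first by case/andP: jn.
    by have := Q j jn; case: (h j).
  have : nfr + i = j by apply: h_inj; rewrite ?inE ?e ?ej //=; apply: ltF.
  by lia.
pose x i := if h (nfr + i) is inr x then x else (0, 0).
have X i : nfr + i < pg_nv F -> h (nfr + i) = inr (x i).
  by move=> /E[y e]; rewrite /x e.
exists x; split.
- by move=> i /X e; have := hv (nfr + i); rewrite e.
- move=> i j iF jF e; apply: (@addnI nfr); apply: h_inj => //.
  by rewrite !X // e.
- move=> a i an iF; rewrite -h_adj ?inE //=; last by apply/ltF/nan.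
  by rewrite X // A.
- by move=> i j iF jF; rewrite -h_adj // !X.
Qed.

Hypothesis K0 : 0 < K.
Hypothesis Pb : all (instr_bounded K M) P.
Hypothesis halted : size P <= (cm_run P tau (cm_init n)).1.

Lemma run_graph_free F : F \in bad_patterns P K M -> ~ contains_pg run_graph F.
Proof.
move=> /bad_patterns_mem[frF [rho rhoF nogood]] /(run_graph_framed frF)[x [xv xi xa xe]].
apply: nogood; rewrite /pattern_good.
have := construct_good M3 K0 Pb halted (x := fun i => x (rho i)) (fun i => xv _ (rhoF i)).
set l1 := xlab _ _ _ _ _; set l2 := fun i a => _; set l3 := fun i a => _.
set m1 := fun i a => _; set m2 := fun i a => _; set m3 := fun i a => _.
have -> : m1 = l1.
  apply: funext => i; apply: funext => a; rewrite /m1 /l1 /xlab.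
  by case: ltnP => //= an; rewrite xa.
have -> : m2 = l2.
  by apply: funext => i; apply: funext => j; rewrite /m2 /l2 xe.
have -> // : m3 = l3.
apply: funext => i; apply: funext => j; rewrite /m3 /l3.
by apply/eqP/eqP => [-> //|]; apply: xi.
Qed.

End RunGraph.

Arguments run_graph : clear implicits.
Arguments of_vert : clear implicits.

(** * The two families of pathographs *)

Section Pathographs.
Variables (K M : nat).
Hypothesis K0 : 0 < K.
Hypothesis M3 : 2 < M.

Notation nanc := (nanc K M).
Notation nfr := (nfr K M).
Notation fedge := (fedge K M).
Notation anc := (anc M).
Notation pI := (pI K).

Definition frame_edges : seq (nat * nat) := [seq p <- all_pairs nfr | fedge p.1 p.2].

(** Each step prepends a fixed number of pairs, so that the code of the list is computed by
    primitive recursion; [input_spokes] and [mark_patterns] have this shape for the same reason. *)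
Fixpoint ipath_edges (i : nat) : seq (nat * nat) :=
  if i is j.+1 then (nfr + j, nfr + i) :: (anc pI (i %% M), nfr + i) :: ipath_edges j
  else (0, nfr) :: (anc pI 0, nfr) :: frame_edges.

Definition path_spokes (k : nat) : seq (nat * nat) :=
  [seq (anc p c, p) | p <- iota 0 k, c <- iota 0 M].

Fixpoint input_spokes (i : nat) : seq (nat * nat) :=
  if i is j.+1 then (nfr + i, pR 0) :: input_spokes j
  else (nfr, pR 0) :: path_spokes K.+2.

Definition time_rungs : seq (nat * nat) := [seq (pT, p) | p <- iota 1 K.+1].

(** As the input path is no urpath here, its contact with register 0 is one spoke from each of its
    vertices, where [generic_pg] has a rung. *)
Definition input_pg (n : nat) : pathograph :=
  Pathograph (nfr + (n + M).+1) K.+2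
    ((2, nfr + n) :: (1, nfr + (n + M)) :: ipath_edges (n + M))
    (input_spokes (n + M)) time_rungs (nseq K.+2 (0, 1)).

Definition generic_pg : pathograph :=
  Pathograph nfr (npaths K) frame_edges ((2, pI) :: path_spokes (npaths K))
    ((pI, pR 0) :: time_rungs) (nseq (npaths K) (0, 1)).

(** No path vertex sees anchor 1, so a copy along the input path stops before the end of that path.
    Only its last vertex is marked, which makes it the first mark. *)
Definition mark_pattern (i : nat) : pathograph :=
  Pathograph (nfr + i.+1) 0 ((2, nfr + i) :: ipath_edges i) [::] [::] [::].
Definition nomark_pattern (i : nat) : pathograph :=
  Pathograph (nfr + i.+1) 0 (ipath_edges i) [::] [::] [::].

Fixpoint mark_patterns (i : nat) : seq pathograph :=
  if i is j.+1 then mark_pattern j :: mark_patterns j else [::].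

Lemma fedge_sym a b : fedge a b = fedge b a.
Proof. exact: (vadj_sym [::] K M 0 0 (inl a) (inl b)). Qed.

Lemma fedge_irr a : fedge a a = false.
Proof. by rewrite /fedge eqxx !andbF /=; apply/negbTE/negP => /orP[] /and3P[]; lia. Qed.

Lemma nanc_lt a : a < nanc -> a < nfr.
Proof. by rewrite /nfr; lia. Qed.

Lemma anc_input_lt j : anc pI (j %% M) < nfr.
Proof.
apply: nanc_lt; apply: anc_lt; first by rewrite /npaths /pI.
by rewrite ltn_mod; lia.
Qed.

Lemma mem_frame_edges a b : ((a, b) \in frame_edges) = [&& a < nfr, b < nfr & fedge a b].
Proof. by rewrite mem_filter mem_all_pairs /= andbC -andbA. Qed.

Definition input_pred (a j : nat) : bool :=
  (a == anc pI (j %% M)) || (if j is i.+1 then a == nfr + i else a == 0).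

Lemma mem_ipath_edges l a b : ((a, b) \in ipath_edges l) =
  [&& a < nfr, b < nfr & fedge a b] || [&& nfr <= b, b <= nfr + l & input_pred a (b - nfr)].
Proof.
have pE (c d a' b' : nat) : ((a', b') == (c, d)) = (a' == c) && (b' == d) by [].
elim: l => [|l IH]; rewrite [ipath_edges _]/= !in_cons !pE.
  rewrite mem_frame_edges addn0 /input_pred.
  case: (ltngtP b nfr) => [h|h|->]; rewrite ?andbF ?orbF //=.
  by rewrite subnn mod0n !andbT orbC.
rewrite IH; case: (b =P nfr + l.+1) => [->|ne]; last first.
  rewrite !andbF /=; congr orb.
  by case: (nfr <= b) => //=; congr andb; lia.
have -> : (nfr + l.+1 < nfr) = false by lia.
have -> : (nfr + l.+1 <= nfr + l) = false by lia.
rewrite !andbF !andbT leq_addr leqnn addKn /= /input_pred orbF orbC //.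
Qed.

(** * Adjacency in a graph made of the frame and an input path *)

Section IPathEdges.
Variables (F : pathograph) (ex : seq (nat * nat)) (l : nat).
Hypothesis FE : pg_E F = ex ++ ipath_edges l.
Hypothesis exP : forall a b, (a, b) \in ex -> a < nfr <= b.

Lemma pg_edge_frame : {in gtn nfr &, forall a b, pg_edge F a b = fedge a b}.
Proof.
move=> a b; rewrite !inE /= => an bn.
have H c d : c < nfr -> d < nfr -> ((c, d) \in pg_E F) = fedge c d.
  move=> cn dn; rewrite FE mem_cat mem_ipath_edges cn dn /= leqNgt dn /= orbF.
  by case e : ((c, d) \in ex) => //; have := exP e; lia.
by rewrite /pg_edge !H // [fedge b a]fedge_sym orbb.
Qed.

Lemma pg_edge_label a j : a < nfr -> j <= l -> pg_edge F a (nfr + j) =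
  [|| (a, nfr + j) \in ex, a == anc pI (j %% M) | (a == 0) && (j == 0)].
Proof.
move=> an jl; rewrite /pg_edge !FE !mem_cat !mem_ipath_edges.
have -> : (nfr + j < nfr) = false by lia.
have -> : (nfr <= a) = false by lia.
rewrite an /= leq_addr leq_add2l jl addKn orbF /=.
have -> : ((nfr + j, a) \in ex) = false.
  by apply/negbTE/negP => /exP; lia.
rewrite orbF; congr orb; rewrite /input_pred; congr orb.
by case: j {jl} => [|j]; rewrite ?andbT // andbF; apply/eqP; lia.
Qed.

Lemma pg_edge_path i j : i <= l -> j <= l ->
  pg_edge F (nfr + i) (nfr + j) = (i.+1 == j) || (j.+1 == i).
Proof.
have H c d : d <= l -> ((nfr + c, nfr + d) \in pg_E F) = (c.+1 == d).
  move=> dl; rewrite FE mem_cat mem_ipath_edges.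
  have -> : (nfr + c < nfr) = false by lia.
  have -> : ((nfr + c, nfr + d) \in ex) = false by apply/negbTE/negP => /exP; lia.
  rewrite /= leq_addr leq_add2l dl addKn /= /input_pred.
  have := anc_input_lt d; case: (_ =P _) => [<-|_ _ /=]; first by lia.
  by case: d {dl} => [|d]; rewrite ?eqSS ?eqn_add2l //; apply/eqP; rewrite /nfr /nanc; lia.
by move=> il jl; rewrite /pg_edge !H // [i.+1 == j]eq_sym; do 2 case: eqP => //; lia.
Qed.

Lemma ipath_edges_wf v : pg_nv F = v -> nfr + l < v ->
  (forall a b, (a, b) \in ex -> b < v) ->
  all (fun p => [&& p.1 < pg_nv F, p.2 < pg_nv F & p.1 != p.2]) (pg_E F).
Proof.
move=> -> lv exv; apply/allP => -[a b]; rewrite FE mem_cat => /orP[h|] /=.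
  by have := exP h; have := exv _ _ h; lia.
rewrite mem_ipath_edges => /orP[/and3P[h1 h2 h3]|/and3P[h1 h2]].
  by rewrite (contraTneq _ h3) ?andbT => [|->]; [lia|rewrite fedge_irr].
have := anc_input_lt (b - nfr).
by rewrite /input_pred => ? /orP[/eqP ->|]; [lia|case e : (b - nfr) => [|i] /eqP ->; lia].
Qed.

End IPathEdges.

Lemma mem_path_spokes k a p : ((a, p) \in path_spokes k) =
  (p < k) && has (fun c => a == anc p c) (iota 0 M).
Proof.
apply/allpairsPdep/andP => [[q [c [hq hc [-> ->]]]]|[hp /hasP[c hc /eqP ->]]].
  rewrite mem_iota add0n in hq; split=> //.
  by apply/hasP; exists c.
by exists p, c; rewrite mem_iota.
Qed.

Lemma mem_input_spokes l a p : ((a, p) \in input_spokes l) =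
  ((p < K.+2) && has (fun c => a == anc p c) (iota 0 M)) ||
  [&& p == pR 0, nfr <= a & a <= nfr + l].
Proof.
have pE (c d a' b' : nat) : ((a', b') == (c, d)) = (a' == c) && (b' == d) by [].
elim: l => [|l IH]; rewrite [input_spokes _]/= in_cons pE.
  rewrite mem_path_spokes addn0 orbC; congr orb.
  by rewrite -eqn_leq eq_sym andbC.
rewrite IH orbCA; congr orb.
by case: (p == pR 0); rewrite ?andbF //= andbT; lia.
Qed.

Lemma time_rungs_mem p q : ((p, q) \in time_rungs) = (p == pT) && (0 < q <= K.+1).
Proof.
apply/mapP/andP => [[r]|[/eqP -> h]].
  by rewrite mem_iota add1n => h [-> ->].
by exists q => //; rewrite mem_iota add1n.
Qed.

Lemma time_rungs_wf nu : K.+1 < nu ->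
  all (fun p => [&& p.1 < nu, p.2 < nu & p.1 != p.2]) time_rungs.
Proof.
move=> h; apply/allP => -[p q]; rewrite time_rungs_mem /pT => /andP[/eqP ->] /=; lia.
Qed.

Lemma nfr_gt3 : 3 < nfr. Proof. by rewrite /nfr /nclq /nanc; lia. Qed.

Lemma pg_edge_01 F ex l : pg_E F = ex ++ ipath_edges l ->
  (forall a b, (a, b) \in ex -> a < nfr <= b) -> pg_edge F 0 1 = false.
Proof.
by move=> FE exP; rewrite (pg_edge_frame FE exP).
Qed.

Definition input_marks (n : nat) := [:: (2, nfr + n); (1, nfr + (n + M))].

Lemma input_marksP n a b : (a, b) \in input_marks n -> a < nfr <= b.
Proof. by have := nfr_gt3; rewrite !inE => ? /orP[] /eqP[-> ->]; lia. Qed.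

Lemma input_pg_wf n : pg_wf (input_pg n).
Proof.
have n3 := nfr_gt3.
have FE : pg_E (input_pg n) = input_marks n ++ ipath_edges (n + M) by [].
apply/and5P; split; last (apply/andP; split).
- apply: (ipath_edges_wf (v := nfr + (n + M).+1) FE (@input_marksP n)) => //; first by lia.
  by move=> a b; rewrite !inE => /orP[] /eqP[_ ->]; lia.
- apply/allP => -[a p]; rewrite -[pg_S _]/(input_spokes (n + M)) mem_input_spokes.
  rewrite [pg_nv _]/= [pg_nu _]/= => /orP[/andP[h /hasP[c]]|].
    rewrite mem_iota add0n => /andP[_ cM] /eqP -> /=; rewrite h andbT.
    have := nanc_lt (anc_lt (K := K) (p := p) _ cM).
    by move=> H; apply: leq_trans (H _) _; rewrite /npaths; lia.
  by rewrite /pR => /and3P[/eqP -> h1 h2] /=; lia.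
- exact: time_rungs_wf.
- by rewrite /= size_nseq.
- apply/allP => p /nseqP[-> _] /=; lia.
- by apply/allP => p /nseqP[-> _] /=; rewrite (pg_edge_01 FE (@input_marksP n)).
Qed.

Lemma generic_pg_edge : {in gtn nfr &, forall a b, pg_edge generic_pg a b = fedge a b}.
Proof.
move=> a b; rewrite !inE /= => an bn.
rewrite /pg_edge -[pg_E _]/frame_edges !mem_frame_edges an bn /=.
by rewrite [fedge b a]fedge_sym orbb.
Qed.

Lemma generic_pg_wf : pg_wf generic_pg.
Proof.
have n3 := nfr_gt3.
apply/and5P; split; last (apply/andP; split).
- apply/allP => -[a b]; rewrite -[pg_E _]/frame_edges mem_frame_edges.
  move=> /and3P[h1 h2 h3]; apply/and3P; split=> //.
  by apply: contraTneq h3 => /= ->; rewrite fedge_irr.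
- apply/allP => -[a p]; rewrite -[pg_S _]/((2, pI) :: path_spokes (npaths K)).
  rewrite in_cons mem_path_spokes => /orP[/eqP[-> ->]|/andP[h /hasP[c]]] /=.
    by rewrite /pI /npaths; lia.
  rewrite mem_iota add0n => /andP[_ cM] /eqP ->; rewrite h andbT.
  exact: nanc_lt (anc_lt h cM).
- apply/andP; split; last exact: time_rungs_wf.
  by rewrite /= /pI /pR /npaths; lia.
- by rewrite /= size_nseq.
- by apply/allP => p /nseqP[-> _] /=; lia.
- apply/allP => p /nseqP[-> _] /=; rewrite generic_pg_edge ?inE /=; lia.
Qed.

Lemma marksP i a b : (a, b) \in [:: (2, nfr + i)] -> a < nfr <= b.
Proof. by have := nfr_gt3; rewrite !inE => ? /eqP[-> ->]; lia. Qed.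

Lemma nomarksP a b : (a, b) \in [::] -> a < nfr <= b.
Proof. by []. Qed.

Lemma pattern_wf ex i : (forall a b, (a, b) \in ex -> a < nfr <= b) ->
  (forall a b, (a, b) \in ex -> b < nfr + i.+1) ->
  pg_wf (Pathograph (nfr + i.+1) 0 (ex ++ ipath_edges i) [::] [::] [::]).
Proof.
move=> exP exv; set F := Pathograph _ _ _ _ _ _; apply/andP; split; last by [].
have FE : pg_E F = ex ++ ipath_edges i by [].
by apply: (ipath_edges_wf (v := nfr + i.+1) FE exP) => //; lia.
Qed.

Lemma mark_pattern_wf i : pg_wf (mark_pattern i).
Proof.
apply: (@pattern_wf [:: (2, nfr + i)]); first exact: marksP.
by move=> a b; rewrite !inE => /eqP[_ ->]; lia.
Qed.

Lemma nomark_pattern_wf i : pg_wf (nomark_pattern i).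
Proof. exact: (@pattern_wf [::]). Qed.

Lemma mark_patterns_wf i : all pg_wf (mark_patterns i).
Proof. by elim: i => //= i ->; rewrite mark_pattern_wf. Qed.

Lemma mark_patternsP i F : F \in mark_patterns i -> exists2 j, j < i & F = mark_pattern j.
Proof.
elim: i => //= i IH; rewrite in_cons => /orP[/eqP ->|/IH[j ji ->]].
  by exists i.
by exists j => //; apply: ltnW.
Qed.

Lemma mem_mark_patterns i j : j < i -> mark_pattern j \in mark_patterns i.
Proof.
elim: i => // i IH; rewrite ltnS leq_eqVlt [mark_patterns _]/= in_cons.
by move=> /orP[/eqP ->|/IH ->]; rewrite ?eqxx ?orbT.
Qed.

Lemma pattern_framed ex i : (forall a b, (a, b) \in ex -> a < nfr <= b) ->
  framed K M (Pathograph (nfr + i.+1) 0 (ex ++ ipath_edges i) [::] [::] [::]).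
Proof.
move=> exP; set F := Pathograph _ _ _ _ _ _.
have FE : pg_E F = ex ++ ipath_edges i by [].
by split=> //; [apply: leq_addr|apply: pg_edge_frame FE exP].
Qed.

(** * Initial segments of the input path inside the run graph *)

Section RunGraphPatterns.
Variables (P : seq instr) (n tau : nat).

(** Rigidity fixes the anchors. Anchor 0 and the colour then pin the first vertex of the pattern to
    the start of the input path, and adjacency with the next colour pins each further vertex to its
    successor. *)
Lemma pattern_path ex i : (forall a b, (a, b) \in ex -> a < nfr <= b) ->
  contains_pg (run_graph P K M n tau)
    (Pathograph (nfr + i.+1) 0 (ex ++ ipath_edges i) [::] [::] [::]) ->
  forall a, a < nanc ->
    vlab K M n tau a (pI, i) = [|| (a, nfr + i) \in ex, a == anc pI (i %% M) | (a == 0) && (i == 0)].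
Proof.
move=> exP; set F := Pathograph _ _ _ _ _ _ => cF.
have FE : pg_E F = ex ++ ipath_edges i by [].
have [x [xv _ xa xe]] := run_graph_framed M3 (@pattern_framed ex i exP) cF.
have Fn j : j <= i -> nfr + j < pg_nv F by move=> h; rewrite [pg_nv F]/= ltn_add2l.
have M0 : 0 < M by lia.
have ipn : pI < npaths K by rewrite /npaths /pI.
have X j : j <= i -> (x j).1 = pI /\ (x j).2 %% M = j %% M.
  move=> ji; have vj := xv j (Fn j ji).
  have al : anc pI (j %% M) < nanc by apply: anc_lt; rewrite // ltn_mod.
  have := xa _ j al (Fn j ji).
  rewrite (pg_edge_label FE exP) ?nanc_lt // eqxx orbT /= => /esym.
  rewrite /vlab => /or4P[/andP[/eqP]|/andP[/eqP]|/and3P[/eqP]|/eqP]; try by rewrite /anc; lia.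
  by case/anc_inj; rewrite ?ltn_mod // => -> ->.
have XJ j : j <= i -> x j = (pI, j).
  elim: j => [|j IH] ji.
    have [e1 _] := X 0 ji.
    have := xa 0 0 isT (Fn 0 ji).
    rewrite (pg_edge_label FE exP) // !orbT => /esym.
    rewrite /vlab /= !orbF => /eqP e2.
    by rewrite [x 0]surjective_pairing e1 e2.
  have [e1 e2] := X j.+1 ji.
  have := xe j j.+1 (Fn j (ltnW ji)) (Fn _ ji).
  rewrite (pg_edge_path FE exP (ltnW ji) ji) eqxx /= IH ?(ltnW ji) // => /esym.
  rewrite [x j.+1]surjective_pairing e1 => /(eadj_next M3) ->; first by [].
  by rewrite e2 nextc_mod.
move=> a an; rewrite -(XJ i (leqnn i)) -xa ?Fn //.
by rewrite (pg_edge_label FE exP) // nanc_lt.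
Qed.

Lemma run_graph_no_mark i : i != n -> ~ contains_pg (run_graph P K M n tau) (mark_pattern i).
Proof.
move=> ne /(@pattern_path [:: (2, nfr + i)] i (@marksP i)) /(_ 2 isT).
by rewrite inE eqxx /= /vlab /= (negPf ne) andbF /= /anc; lia.
Qed.

Lemma run_graph_mark : ~ contains_pg (run_graph P K M n tau) (nomark_pattern n).
Proof.
move=> /(@pattern_path [::] n nomarksP) /(_ 2 isT).
by rewrite /vlab !eqxx /= /anc; lia.
Qed.

End RunGraphPatterns.
End Pathographs.

Lemma generic_pg_spoke K M a u : u < npaths K -> pg_spoke (generic_pg K M) a u =
    (a == 2) && (u == pI K) || has (fun c => a == anc M u c) (iota 0 M).
Proof.
move=> un; rewrite /pg_spoke -[pg_S _]/((2, pI K) :: path_spokes M (npaths K)).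
by rewrite in_cons mem_path_spokes un.
Qed.

Lemma input_pg_spoke K M n a u : 0 < K -> 2 < M -> u < K.+2 ->
  pg_spoke (input_pg K M n) a u = has (fun c => a == anc M u c) (iota 0 M) ||
    [&& u == pR 0, nfr K M <= a & a <= nfr K M + (n + M)].
Proof.
move=> K0 M3 un; rewrite /pg_spoke -[pg_S _]/(input_spokes K M (n + M)).
by rewrite mem_input_spokes // un.
Qed.

(** * The run graph as a realization of both pathographs *)

Section Realize.
Variables (P : seq instr) (K M n tau : nat).
Hypothesis K0 : 0 < K.
Hypothesis M3 : 2 < M.

Notation vlab := (vlab K M n tau).
Notation eadj := (eadj P K M n).
Notation valid := (valid K M n tau).
Notation vvalid := (vvalid K M n tau).
Notation vadj := (vadj P K M n tau).
Notation nanc := (nanc K M).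
Notation nfr := (nfr K M).
Notation fedge := (fedge K M).
Notation plen := (plen K M n tau).
Notation pI := (pI K).
Notation of_vert := (of_vert K M n tau).

Lemma plen_gt p : n + M < plen p.
Proof. by rewrite /plen /bound; case: eqP => _; lia. Qed.

(** [F] places the ordinary vertices, while urpath [u] is always path [u] of the run. The edges of
    spokes and rungs are read off the adjacency itself, which leaves only the conditions in which
    the two pathographs differ. *)
Lemma run_graph_realizes (H : pathograph) (F : nat -> nat + nat * nat) :
  pg_nu H <= npaths K -> pg_pi H = nseq (pg_nu H) (0, 1) ->
  (forall a, a < pg_nv H -> vvalid (F a)) ->
  {in gtn (pg_nv H) &, injective F} ->
  (forall a u i, a < pg_nv H -> u < pg_nu H -> F a <> inr (u, i)) ->
  (forall v, vvalid v -> (exists2 a, a < pg_nv H & F a = v) \/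
     (exists u i, [/\ u < pg_nu H, i < plen u & v = inr (u, i)])) ->
  {in gtn (pg_nv H) &, forall a b, vadj (F a) (F b) = pg_edge H a b} ->
  (forall a u i, a < pg_nv H -> u < pg_nu H -> i < plen u ->
     vadj (F a) (inr (u, i)) =
       [|| (a == 0) && (i == 0), (a == 1) && (i == (plen u).-1) |
           pg_spoke H a u && vadj (F a) (inr (u, i))]) ->
  (forall a u, a < pg_nv H -> u < pg_nu H -> pg_spoke H a u ->
     exists2 i, i < plen u & vadj (F a) (inr (u, i))) ->
  (forall u i u' j, u < pg_nu H -> u' < pg_nu H -> u != u' ->
     eadj (u, i) (u', j) -> pg_rung H u u') ->
  (forall u u', u < pg_nu H -> u' < pg_nu H -> u != u' -> pg_rung H u u' ->
     exists i j, [/\ i < plen u, j < plen u' & eadj (u, i) (u', j)]) ->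
  realizes_on H (run_graph P K M n tau) predT.
Proof.
move=> nuN piH Fv Fi Fu Fsurj Fadj Flab Fsp Frg Frg'.
have gv u i : u < pg_nu H -> i < plen u -> vvalid (inr (u, i)).
  by move=> un il; rewrite /= /valid /= il (leq_trans un).
have pi1 u : u < pg_nu H -> pg_end1 H u = 0 by rewrite /pg_end1 piH nth_nseq => ->.
have pi2 u : u < pg_nu H -> pg_end2 H u = 1 by rewrite /pg_end2 piH nth_nseq => ->.
exists (fun a => of_vert (F a)), (fun u i => of_vert (inr (u, i))), plen,
  (fun a u i => vadj (F a) (inr (u, i))), (fun u i u' j => eadj (u, i) (u', j)).
split; first by move=> u _; have := plen_gt u; lia.
split=> //; split=> //.
split.
  by move=> a b av bv /(congr1 (@to_vert K M n tau)); rewrite !of_vertK ?Fv //; apply: Fi.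
split.
  move=> u i u' j un il un' jl /(congr1 (@to_vert K M n tau)).
  by rewrite !of_vertK ?gv // => -[-> ->].
split.
  move=> a u i av un il /(congr1 (@to_vert K M n tau)).
  by rewrite !of_vertK ?gv ?Fv //; apply: Fu.
split.
  move=> x _; case: (Fsurj _ (to_vert_valid x)) => [[a av e]|[u [i [un il e]]]].
    by left; exists a; rewrite // e to_vertK.
  by right; exists u, i; split=> //; rewrite -e to_vertK.
split.
  by move=> a b av bv; rewrite /run_graph !of_vertK ?Fv //; apply: Fadj.
split.
  move=> a u i av un il; rewrite /run_graph !of_vertK ?Fv ?gv // pi1 // pi2 //.
  exact: Flab.
split; first exact: Fsp.
split; last exact: Frg'.
move=> u i u' j un il un' jl; rewrite /run_graph !of_vertK ?gv //=.
case: eqP => [<-|/eqP ne]; first by rewrite /eadj eqxx.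
by case e : (eadj _ _); rewrite ?andbF // (Frg _ _ _ _ un un' ne e).
Qed.

Lemma vlab_spoke a u i : valid (u, i) -> vlab a (u, i) =
  [|| (a == 0) && (i == 0), (a == 1) && (i == (plen u).-1) |
      [|| (a == 2) && (u == pI) | has (fun c => a == anc M u c) (iota 0 M)] && vlab a (u, i)].
Proof.
move=> v; case e : (vlab a (u, i)); rewrite ?andbF ?andbT ?orbF.
  move: e; rewrite /vlab /= => /or4P[->|->|/and3P[-> -> _]|/eqP e]; rewrite ?orbT //.
  apply/esym/or3P; apply: Or33; apply/orP; right; apply/hasP; exists (i %% M); last exact/eqP.
  by rewrite mem_iota add0n ltn_mod; lia.
by move/norP: e => [/negPf -> /norP[/negPf ->]].
Qed.

Lemma vlab_mark : vlab 2 (pI, n). Proof. by rewrite /vlab !eqxx !orbT. Qed.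

Lemma vlab_anc u c : c < M -> vlab (anc M u c) (u, c).
Proof. by move=> cM; rewrite /vlab /= modn_small // eqxx !orbT. Qed.

Lemma eadj_rung u i u' j : u != u' -> eadj (u, i) (u', j) ->
  [|| (u == pT) && (0 < u' <= K.+1), (u' == pT) && (0 < u <= K.+1),
      (u == pI) && (u' == pR 0) | (u' == pI) && (u == pR 0)].
Proof.
rewrite /eadj /rung /= => /negPf -> /orP[] /or3P[] /and3P[].
all: rewrite /pPC /pR /pT /pI => /eqP -> h; try (by rewrite h ?orbT).
all: by rewrite ?(eqP h) /=; lia.
Qed.

Lemma time_rung_ex u : 0 < u <= K.+1 ->
  exists i j, [/\ i < plen pT, j < plen u & eadj (pT, i) (u, j)].
Proof.
move=> /andP[u0 uK]; have p0 := plen_gt pT; have p1 := plen_gt u.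
have tu : (pT == u) = false by rewrite /pT; lia.
case: (u =P pPC K) => [e|ne].
  exists 0, 0; split; [lia|lia|].
  by rewrite /eadj /rung /= tu e eqxx mod0n.
(* At time 0 register [u.-1] holds its initial value, [n] or 0, and [plen_gt] places that position
   on its path. *)
exists 0, ((cm_init n).2 u.-1); split; first by lia.
  by rewrite /= /upd; case: eqP => _; lia.
rewrite /eadj /rung tu /= eqxx u0 /= andbT.
by rewrite (_ : u <= K) ?orbT //; move: ne; rewrite /pPC; lia.
Qed.

Lemma input_rung_ex : exists i j, [/\ i < plen pI, j < plen (pR 0) & eadj (pI, i) (pR 0, j)].
Proof.
have p0 := plen_gt pI; have p1 := plen_gt (pR 0).
by exists 0, 0; split; [lia|lia|rewrite /eadj /rung /= /pI /pR !eqxx ?orbT].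
Qed.

Lemma generic_pg_realized : realizes_on (generic_pg K M) (run_graph P K M n tau) predT.
Proof.
have nv : pg_nv (generic_pg K M) = nfr by [].
have nu : pg_nu (generic_pg K M) = npaths K by [].
have SP a u := @generic_pg_spoke K M a u.
have RG u u' : pg_rung (generic_pg K M) u u' =
    [|| (u == pT) && (0 < u' <= K.+1), (u' == pT) && (0 < u <= K.+1),
      (u == pI) && (u' == pR 0) | (u' == pI) && (u == pR 0)].
  rewrite /pg_rung -[pg_R _]/((pI, pR 0) :: time_rungs K) !(in_cons (pI, pR 0)) !time_rungs_mem.
  rewrite -[(u, u') == _]/((u == pI) && (u' == pR 0)).
  rewrite -[(u', u) == _]/((u' == pI) && (u == pR 0)).
  by do 4 case: (_ && _).
apply: (@run_graph_realizes _ inl); rewrite ?nv ?nu //.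
- by move=> a b _ _ [].
- move=> [a|[u i]] /= h; first by left; exists a.
  by right; exists u, i; case/andP: h.
- by move=> a b an bn /=; rewrite generic_pg_edge.
- move=> a u i an un il; rewrite SP // [vadj _ _]/= -vlab_spoke //.
  by rewrite /valid un.
- move=> a u an un; rewrite SP // => /orP[/andP[/eqP -> /eqP ->]|/hasP[c]].
    exists n; last exact: vlab_mark.
    by have := plen_gt pI; lia.
  rewrite mem_iota add0n => /andP[_ cM] /eqP ->; exists c; last exact: vlab_anc.
  by have := plen_gt u; lia.
- by move=> u i u' j _ _ ne e; rewrite RG; apply: eadj_rung e.
- have S u u' : (exists i j, [/\ i < plen u, j < plen u' & eadj (u, i) (u', j)]) ->
      exists i j, [/\ i < plen u', j < plen u & eadj (u', i) (u, j)].
    by move=> [i [j [? ? ?]]]; exists j, i; rewrite eadj_sym.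
  move=> u u' _ _ _; rewrite RG => /or4P[] /andP[/eqP -> h].
  + exact: time_rung_ex.
  + by apply: S; apply: time_rung_ex.
  + by rewrite (eqP h); apply: input_rung_ex.
  + by rewrite (eqP h); apply: S; apply: input_rung_ex.
Qed.

Lemma input_pg_realized : realizes_on (input_pg K M n) (run_graph P K M n tau) predT.
Proof.
have nv : pg_nv (input_pg K M n) = nfr + (n + M).+1 by [].
have nu : pg_nu (input_pg K M n) = K.+2 by [].
have pIlen : plen pI = (n + M).+1 by rewrite /plen eqxx addn1.
have nK u : u < K.+2 -> (u == pI) = false by rewrite /pI; lia.
pose F a := if a < nfr then inl a else inr (pI, a - nfr) : nat + nat * nat.
have FE : pg_E (input_pg K M n) = input_marks K M n ++ ipath_edges K M (n + M) by [].
have SP a u := @input_pg_spoke K M n a u K0 M3.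
have RG u u' : pg_rung (input_pg K M n) u u' =
    (u == pT) && (0 < u' <= K.+1) || (u' == pT) && (0 < u <= K.+1).
  by rewrite /pg_rung -[pg_R _]/(time_rungs K) !time_rungs_mem.
have ipn : pI < npaths K by rewrite /npaths /pI.
apply: (@run_graph_realizes _ F); rewrite ?nv ?nu //.
- move=> a an; rewrite /F; case: ltnP => //= h.
  by rewrite /valid /= ipn pIlen; lia.
- move=> a b an bn; rewrite /F; case: ltnP => ha; case: ltnP => hb // -[] //; lia.
- by move=> a u i an un; rewrite /F; case: ltnP => // h [e]; have := nK _ un; rewrite e eqxx.
- move=> [a|[u i]] h.
    by left; exists a; [move: h => /=; lia|rewrite /F; case: ltnP h => //= /leq_gtF ->].
  case/andP: h => /= un il; case: (u =P pI) => [e|ne]; last first.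
    by right; exists u, i; split=> //; move: un ne; rewrite /npaths /pI; lia.
  subst u; left; exists (nfr + i); first by rewrite pIlen in il; rewrite ltn_add2l.
  by rewrite /F ltnNge leq_addr /= addKn.
- have lab a j : a < nfr -> j <= n + M -> vlab a (pI, j) = pg_edge (input_pg K M n) a (nfr + j).
    move=> an jl; rewrite (pg_edge_label K0 M3 FE (@input_marksP K M K0 M3 n)) // !inE.
    rewrite -[(a, _) == (2, _)]/((a == 2) && (_ == _)).
    rewrite -[(a, _) == (1, _)]/((a == 1) && (_ == _)).
    rewrite !eqn_add2l /vlab /= eqxx pIlen /=.
    by case: a {an} => [|[|[|a]]] /=; rewrite ?orbF // orbC.
  move=> a b; rewrite !inE /= => an bn; rewrite /F.
  case: ltnP => ha; case: ltnP => hb /=.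
  + by rewrite (pg_edge_frame K0 M3 FE (@input_marksP K M K0 M3 n)).
  + by rewrite lab //; [rewrite subnKC|lia].
  + by rewrite lab //; [rewrite subnKC // /pg_edge orbC|lia].
  + rewrite -{2}(subnKC ha) -{2}(subnKC hb) (pg_edge_path K0 M3 FE (@input_marksP K M K0 M3 n)) //; try lia.
    by rewrite /eadj eqxx.
- move=> a u i an un il; rewrite SP // /F.
  have vu : valid (u, i) by rewrite /valid il andbT; apply: leq_trans un _.
  case: ltnP => ha /=.
    by rewrite andbF orbF [LHS]vlab_spoke // nK // andbF.
  have n3 := nfr_gt3 K0 M3.
  have -> : (a == 0) = false by lia.
  have -> : (a == 1) = false by lia.
  case e : (eadj _ _); rewrite ?andbF //= andbT.
  have : pI != u by rewrite eq_sym nK.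
  move=> /eadj_rung /(_ e) /or4P[] /andP[h1 h2].
  + by rewrite /pI /pT in h1.
  + by move: h2; rewrite /pI; lia.
  + by rewrite h2 /=; apply/esym/orP; right; lia.
  + by rewrite nK in h1.
- move=> a u an un; rewrite SP // => /orP[/hasP[c]|/and3P[/eqP -> h1 h2]].
    rewrite mem_iota add0n => /andP[_ cM] /eqP ->; exists c; first by have := plen_gt u; lia.
    rewrite /F nanc_lt //; first exact: vlab_anc.
    by apply: anc_lt => //; apply: leq_trans un _.
  exists (a - nfr); first by have := plen_gt (pR 0); lia.
  by rewrite /F ltnNge h1 /= /eadj /rung /= /pI /pR !eqxx ?orbT.
- move=> u i u' j un un' ne e; rewrite RG.
  by have /or4P[->|->|/andP[]|/andP[]] := eadj_rung ne e; rewrite ?orbT // nK.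
- move=> u u' _ _ _; rewrite RG => /orP[] /andP[/eqP -> h]; first exact: time_rung_ex.
  have [i [j [? ? ?]]] := time_rung_ex h.
  by exists j, i; rewrite eadj_sym.
Qed.

End Realize.

(** * Free realizations and halting *)

Section Equivalence.
Variables (P : seq instr) (K M : nat).
Hypothesis K0 : 0 < K.
Hypothesis M3 : 2 < M.
Hypothesis Pb : all (instr_bounded K M) P.

Notation nanc := (nanc K M).
Notation nfr := (nfr K M).
Notation fedge := (fedge K M).
Notation pI := (pI K).

Lemma has_anc p p' c : c < M -> has (fun d => anc M p' c == anc M p d) (iota 0 M) = (p' == p).
Proof.
move=> cM; apply/hasP/eqP => [[d]|->]; last by exists c; rewrite ?mem_iota.
by rewrite mem_iota add0n => /andP[_ dM] /eqP /anc_inj[].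
Qed.

Lemma has_anc_small a p : a < 3 -> has (fun d => a == anc M p d) (iota 0 M) = false.
Proof. by move=> a3; apply/negbTE/hasPn => d _; rewrite /anc; lia. Qed.

Lemma has_anc_clique a p : nanc <= a -> p < npaths K ->
  has (fun d => a == anc M p d) (iota 0 M) = false.
Proof.
move=> na pn; apply/negbTE/hasPn => d; rewrite mem_iota add0n => /andP[_ dM].
by have := anc_lt pn dM; lia.
Qed.

Lemma free_mem Fs n (adj : rel 'I_n) :
  (forall i, i < size Fs -> ~ contains_pg adj (nth pg_empty Fs i)) <->
  (forall F, F \in Fs -> ~ contains_pg adj F).
Proof.
split=> H; last by move=> i il; apply: H; apply: mem_nth.
by move=> F /(nthP pg_empty)[i il <-]; apply: H.
Qed.

(** Beyond the skeleton, the input path is seen to be induced and to miss the frame clique; this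
    serves to find induced copies of its initial segments. *)
Lemma generic_skeleton N (adj : rel 'I_N) : simple_graph adj ->
  realizes_on (generic_pg K M) adj predT ->
  exists fr el len,
    [/\ skeleton K M adj fr el len,
        exists2 i, i < len pI & adj (fr 2) (el pI i),
        forall a i, nanc <= a -> a < nfr -> i < len pI -> adj (fr a) (el pI i) = false &
        forall i j, i < len pI -> j < len pI ->
          adj (el pI i) (el pI j) = (i.+1 == j) || (j.+1 == i)].
Proof.
move=> [sym _] [f [g [m [sp [rg]]]]].
set H := generic_pg K M.
have -> : pg_nv H = nfr by []. have -> : pg_nu H = npaths K by [].
move=> [m0 [_ [_ [fi [gi [fg [_ [fe [fge [sp0 [ge _]]]]]]]]]]].
have n3 := nfr_gt3 K0 M3.
have E1 u : u < npaths K -> pg_end1 H u = 0 by rewrite /pg_end1 nth_nseq => ->.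
have E2 u : u < npaths K -> pg_end2 H u = 1 by rewrite /pg_end2 nth_nseq => ->.
have S a u : u < npaths K -> _ := @generic_pg_spoke K M a u.
have ipn : pI < npaths K by rewrite /npaths /pI.
have lab a u i : a < nfr -> u < npaths K -> i < m u -> adj (f a) (g u i) =
   [|| (a == 0) && (i == 0), (a == 1) && (i == (m u).-1) |
       ((a == 2) && (u == pI) || has (fun c => a == anc M u c) (iota 0 M)) && sp a u i].
  by move=> an un im; rewrite fge // E1 // E2 // S.
exists f, g, m; split.
- split.
  + by move=> a b an bn; apply: fi.
  + by move=> a b an bn; rewrite fe // generic_pg_edge.
  + by move=> a p i an pn im; apply/eqP; apply: fg.
  + by move=> p i j pn im jm /gi[].
  + exact: m0.
  + move=> p i pn im; rewrite lab //.
    by rewrite has_anc_small //= orbF.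
  + move=> p i pn im; rewrite lab //.
    by rewrite has_anc_small //= orbF.
  + move=> p i p' c pn im pn' cM.
    have an := anc_lt pn' cM; rewrite lab //; last exact: nanc_lt an.
    by rewrite has_anc // /anc /= => /andP[/eqP].
  + move=> c cM; have pn : pPC K < npaths K by rewrite /npaths /pPC.
    have an := nanc_lt K0 M3 (anc_lt pn cM).
    have hs : pg_spoke H (anc M (pPC K) c) (pPC K) by rewrite S // has_anc // eqxx orbT.
    have [i im spi] := sp0 _ _ an pn hs; exists i => //.
    by rewrite lab // has_anc // eqxx orbT spi !orbT.
  + by move=> p i pn im; rewrite ge ?(ltnW im) // eqxx eqxx.
- have hs : pg_spoke H 2 pI by rewrite S // eqxx eqxx.
  have [|i im spi] := sp0 2 pI _ ipn hs; first by lia.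
  by exists i => //; rewrite lab ?eqxx ?spi //; lia.
- move=> a i na an im; rewrite lab // has_anc_clique //.
  have a3 : 2 < a by apply: leq_trans na; rewrite /nanc; lia.
  by rewrite !(gtn_eqF (leq_trans _ a3)).
- by move=> i j im jm; rewrite ge // eqxx.
Qed.

Lemma input_skeleton n N (adj : rel 'I_N) : simple_graph adj ->
  realizes_on (input_pg K M n) adj predT ->
  exists fr el len,
    [/\ skeleton K M adj fr el len, n < len pI & adj (fr 2) (el pI n)].
Proof.
move=> [sym _] [f [g [m [sp [rg]]]]].
set H := input_pg K M n.
have -> : pg_nv H = nfr + (n + M).+1 by []. have -> : pg_nu H = K.+2 by [].
move=> [m0 [_ [_ [fi [gi [fg [_ [fe [fge [sp0 [ge _]]]]]]]]]]].
have n3 := nfr_gt3 K0 M3.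
have E1 u : u < K.+2 -> pg_end1 H u = 0 by rewrite /pg_end1 nth_nseq => ->.
have E2 u : u < K.+2 -> pg_end2 H u = 1 by rewrite /pg_end2 nth_nseq => ->.
have S a u : u < K.+2 -> _ := @input_pg_spoke K M n a u K0 M3.
have FE : pg_E H = input_marks K M n ++ ipath_edges K M (n + M) by [].
have MP := @input_marksP K M K0 M3 n.
have ipn : pI < npaths K by rewrite /npaths /pI.
have lab a u i : a < nfr -> u < K.+2 -> i < m u -> adj (f a) (g u i) =
   [|| (a == 0) && (i == 0), (a == 1) && (i == (m u).-1) |
       has (fun c => a == anc M u c) (iota 0 M) && sp a u i].
  move=> an un im; rewrite fge //; last by lia.
  by rewrite E1 // E2 // S // (leqNgt _ a) an /= andbF orbF.
have labI a i : a < nfr -> i <= n + M -> adj (f a) (f (nfr + i)) =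
   [|| (a == 2) && (i == n), (a == 1) && (i == n + M),
       a == anc M pI (i %% M) | (a == 0) && (i == 0)].
  move=> an il; rewrite fe //; [|lia|lia].
  rewrite (pg_edge_label K0 M3 FE MP) // !inE.
  rewrite -[(a, _) == (2, _)]/((a == 2) && (_ == _)).
  rewrite -[(a, _) == (1, _)]/((a == 1) && (_ == _)).
  by rewrite !eqn_add2l -!orbA.
(* The ordinary vertices beyond the frame serve as path [pI]; the other paths are urpaths. *)
pose el p i := if p == pI then f (nfr + i) else g p i.
pose len p := if p == pI then (n + M).+1 else m p.
have cases p : p < npaths K -> p = pI \/ ((p == pI) = false /\ p < K.+2).
  by rewrite /npaths /pI => pn; case: eqP => [->|]; [left|right; split=> //; lia].
have lI : len pI = (n + M).+1 by rewrite /len eqxx.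
have eI i : el pI i = f (nfr + i) by rewrite /el eqxx.
have M0 : 0 < M by lia.
exists f, el, len; split; last 2 first.
- by rewrite lI; lia.
- by rewrite eI labI ?eqxx //; lia.
split.
- by move=> a b; rewrite !inE /= => an bn; apply: fi; lia.
- move=> a b; rewrite !inE /= => an bn; rewrite fe; [|lia|lia].
  by rewrite (pg_edge_frame K0 M3 FE MP).
- move=> a p i an /cases[->|[pI_ pn]]; rewrite /len /el ?eqxx ?pI_ => il; apply/eqP.
    by move=> /fi; lia.
  by apply: fg => //; lia.
- move=> p i j /cases[->|[pI_ pn]]; rewrite /len /el ?eqxx ?pI_ => il jl.
    by move=> /fi; lia.
  by move=> /gi[].
- by move=> p /cases[->|[pI_ pn]]; rewrite /len ?eqxx ?pI_ //; apply: m0.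
- move=> p i /cases[->|[pI_ pn]]; rewrite /len /el ?eqxx ?pI_ => il.
    by rewrite labI //=; lia.
  rewrite lab //.
  by rewrite has_anc_small //= orbF.
- move=> p i /cases[->|[pI_ pn]]; rewrite /len /el ?eqxx ?pI_ => il.
    by rewrite labI //= /anc /= !orbF.
  rewrite lab //.
  by rewrite has_anc_small //= orbF.
- move=> p i p' c /cases[->|[pI_ pn]]; rewrite /len /el ?eqxx ?pI_ => il pn' cM;
    have an := nanc_lt K0 M3 (anc_lt pn' cM).
    rewrite labI // /anc /= orbF => /eqP; rewrite -!/(anc M _ _) => /anc_inj[] //.
    by rewrite ltn_mod.
  by rewrite lab // has_anc // /anc /= => /andP[/eqP].
- move=> c cM; have pn : pPC K < K.+2 by rewrite /pPC.
  have pn' : pPC K < npaths K by rewrite /npaths /pPC.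
  have pI_ : (pPC K == pI) = false by rewrite /pPC /pI; lia.
  have an := nanc_lt K0 M3 (anc_lt pn' cM).
  have hs : pg_spoke H (anc M (pPC K) c) (pPC K) by rewrite S // has_anc // eqxx.
  have [|i im spi] := sp0 _ _ _ pn hs; first by lia.
  exists i; rewrite /len /el pI_ //.
  by rewrite lab // has_anc // eqxx spi !orbT.
- move=> p i /cases[->|[pI_ pn]]; rewrite /len /el ?eqxx ?pI_ => il.
    rewrite fe; [|lia|lia].
    by rewrite (pg_edge_path K0 M3 FE MP) ?eqxx //; lia.
  by rewrite ge ?(ltnW il) // eqxx eqxx.
Qed.

Lemma input_pg_free n :
  has_free_realization (bad_patterns P K M) (input_pg K M n) <-> cm_halts P n.
Proof.
split=> [[N [adj [aG rH /free_mem fr_]]]|[tau halted]].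
  have [fr [el [len [sk nl mk]]]] := input_skeleton aG rH.
  exact: skeleton_halts sk fr_ _ nl mk.
exists (nverts K M n tau), (run_graph P K M n tau); split.
- exact: run_graph_simple.
- exact: input_pg_realized.
- by apply/free_mem => F; apply: run_graph_free.
Qed.

Lemma anc_surj a : 2 < a < nanc -> exists p c, [/\ p < npaths K, c < M & a = anc M p c].
Proof.
move=> /andP[a3 an]; have M0 : 0 < M by lia.
exists ((a - 3) %/ M), ((a - 3) %% M); split; last by rewrite /anc -addnA -divn_eq; lia.
  by rewrite ltn_divLR //; move: an; rewrite /nanc; lia.
by rewrite ltn_mod.
Qed.

(** Colours are forced by the absence of bad patterns, so only the marks can vary; they are passed
    as [ex]. The segment has to stop before the end of the path, as the pattern has no edge to
    anchor 1 there. *)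
Lemma path_pattern_contained N (adj : rel 'I_N) fr el len :
  simple_graph adj -> skeleton K M adj fr el len ->
  (forall F, F \in bad_patterns P K M -> ~ contains_pg adj F) ->
  (forall a i, nanc <= a -> a < nfr -> i < len pI -> adj (fr a) (el pI i) = false) ->
  (forall i j, i < len pI -> j < len pI ->
     adj (el pI i) (el pI j) = (i.+1 == j) || (j.+1 == i)) ->
  forall l ex, l.+1 < len pI -> (forall a b, (a, b) \in ex -> a < nfr <= b) ->
  (forall a j, a < nfr -> j <= l ->
     ((a, nfr + j) \in ex) = if a == 2 then adj (fr 2) (el pI j) else false) ->
  contains_pg adj (Pathograph (nfr + l.+1) 0 (ex ++ ipath_edges K M l) [::] [::] [::]).
Proof.
move=> aG sk free clq pth l ex ll exP exm; have [sym _] := aG.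
set F := Pathograph _ _ _ _ _ _.
have FE : pg_E F = ex ++ ipath_edges K M l by [].
have n3 := nfr_gt3 K0 M3; have M0 : 0 < M by lia.
have ipn : pI < npaths K by rewrite /npaths /pI.
have lab a j : a < nfr -> j <= l -> adj (fr a) (el pI j) = pg_edge F a (nfr + j).
  move=> an jl; have jl' : j < len pI by lia.
  rewrite (pg_edge_label K0 M3 FE exP) // exm //.
  case: (ltnP 2 a) => a2; last first.
    have -> : (a == anc M pI (j %% M)) = false by rewrite /anc; lia.
    case: a an a2 => [|[|[|//]]] an _ /=; rewrite ?orbF.
    - by rewrite (sk_start sk).
    - by rewrite (sk_stop sk) //; lia.
    - by [].
  have -> : (a == 0) = false by lia.
  have -> : (a == 2) = false by lia.
  rewrite orbF /=; case: (ltnP a nanc) => na; last first.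
    rewrite clq //; have := @anc_lt K M pI (j %% M) ipn; rewrite ltn_mod => /(_ M0); lia.
  have [|p [c [pn cM e]]] := @anc_surj a; first by rewrite a2.
  apply/idP/eqP => [h|->].
    have [|e1 e2] := @colored_uniq P K M N adj fr el len K0 M3 Pb aG sk free pI j p c ipn jl'.
      by rewrite /colored pn cM -e.
    by rewrite e e1 e2.
  by have /and3P[] := @colored_el P K M N adj fr el len K0 M3 Pb aG sk free pI j ipn jl'.
pose h a := if a < nfr then fr a else el pI (a - nfr).
apply/contains_no_urpath => //; exists h; split.
  move=> a b; rewrite !inE /= /h => an bn.
  case: ltnP => ha; case: ltnP => hb.
  - by apply: (sk_fr_inj sk).
  - by move/eqP; rewrite (negPf (sk_fr_el sk _ _ _)) //; lia.
  - by move/eqP; rewrite eq_sym (negPf (sk_fr_el sk _ _ _)) //; lia.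
  - by move/(sk_el_inj sk ipn); lia.
move=> a b; rewrite !inE /= /h => an bn.
case: ltnP => ha; case: ltnP => hb.
- by rewrite (sk_fr_adj sk) // (pg_edge_frame K0 M3 FE exP).
- by rewrite lab //; [rewrite subnKC|lia].
- by rewrite sym lab //; [rewrite subnKC // /pg_edge orbC|lia].
- rewrite pth; [|lia|lia].
  rewrite -[in RHS](subnKC ha) -[in RHS](subnKC hb) (pg_edge_path K0 M3 FE exP) //; lia.
Qed.

(** The spoke of anchor 2 guarantees a mark. If the first one is at [i < n], the segment up to it is
    a copy of [mark_pattern K M i]; if it comes after [n], the segment up to [n] is a copy of
    [nomark_pattern K M n]. *)
Lemma generic_pg_free n :
  has_free_realization (bad_patterns P K M ++ nomark_pattern K M n :: mark_patterns K M n)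
    (generic_pg K M) <-> cm_halts P n.
Proof.
split=> [[N [adj [aG rH /free_mem fr_]]]|[tau halted]]; last first.
  exists (nverts K M n tau), (run_graph P K M n tau); split.
  - exact: run_graph_simple.
  - exact: generic_pg_realized.
  - apply/free_mem => F; rewrite mem_cat in_cons => /or3P[h|/eqP ->|h].
    + exact: run_graph_free.
    + exact: run_graph_mark.
    + have [j jn ->] := mark_patternsP h.
      by apply: run_graph_no_mark => //; lia.
have [fr [el [len [sk [i0 i0l i0m] clq pth]]]] := generic_skeleton aG rH.
have free F : F \in bad_patterns P K M -> ~ contains_pg adj F.
  by move=> h; apply: fr_; rewrite mem_cat h.
have ipn : pI < npaths K by rewrite /npaths /pI.
have ex0 : exists i, (i < len pI) && adj (fr 2) (el pI i) by exists i0; rewrite i0l.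
case: (ex_minnP ex0) => i /andP[il im] imin.
have nomark j : j < i -> adj (fr 2) (el pI j) = false.
  move=> ji; apply/negbTE/negP => jm; have := imin j; rewrite jm (ltn_trans ji il); lia.
(* A marked vertex is never the last one, so no vertex of the segment up to the mark sees anchor
   1. *)
have iS : i.+1 < len pI.
  have E := elem_el el ipn il.
  have := good_mark (elem_good aG sk free E E E E E).
  by rewrite !lab_rlab //= (sk_stop sk) // => /(_ im) /eqP; lia.
have C := path_pattern_contained aG sk free clq pth.
case: (ltngtP i n) => [lt_in|lt_ni|<-]; last exact: skeleton_halts sk free _ il im.
- case: (fr_ (mark_pattern K M i)).
    by rewrite mem_cat in_cons mem_mark_patterns ?orbT.
  apply: (C i [:: (2, nfr + i)]) => //; first exact: marksP.
  move=> a j an; rewrite inE leq_eqVlt.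
  rewrite -[(a, _) == _]/((a == 2) && (_ == _)) eqn_add2l => /orP[/eqP ->|ji].
    by rewrite eqxx andbT; case: eqP => // _; rewrite im.
  by rewrite (ltn_eqF ji) andbF; case: eqP => // _; rewrite nomark.
- case: (fr_ (nomark_pattern K M n)).
    by rewrite mem_cat in_cons eqxx ?orbT.
  apply: (C n [::]) => //; first by lia.
  by move=> a j an jn; case: eqP => // _; rewrite nomark //; lia.
Qed.

End Equivalence.

(** * Encodings *)

Lemma code_inj : injective CodeSeq.code.
Proof. exact: can_inj CodeSeq.codeK. Qed.

Lemma code_pairs_inj : injective code_pairs.
Proof.
move=> s t /code_inj; elim: s t => [|[a b] s IH] [|[c d] t] //= [-> -> /IH ->] //.
Qed.

(** A code thus determines its instance, so that asking for some instance with that code is asking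
    about this instance. *)
Lemma encode_pg_inj : injective encode_pg.
Proof.
move=> [v u E S R p] [v' u' E' S' R' p'] /code_inj /=.
by case=> -> -> /code_pairs_inj -> /code_pairs_inj -> /code_pairs_inj -> /code_pairs_inj ->.
Qed.

Lemma encode_pgs_inj : injective encode_pgs.
Proof. by move=> s t /code_inj; apply: inj_map encode_pg_inj _ _. Qed.

Lemma undecidable_reduction (A B : nat -> Prop) (h : nat -> nat) :
  total_rec 1 (fun v => h (nth 0 v 0)) -> (forall n, A (h n) <-> B n) ->
  undecidable_set B -> undecidable_set A.
Proof.
move=> [r Hr] AB uB [f Hf]; apply: uB; exists (RComp f [:: r]) => n.
have C y : reval f [:: h n] y -> reval (RComp f [:: r]) [:: n] y.
  move=> H; apply: ev_comp H; apply: evs_cons; last exact: evs_nil.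
  exact: (Hr [:: n]).
by case: (Hf (h n)) => -[/AB h1 /C h2]; [left|right; split=> // /AB].
Qed.

Lemma bounds_exist (P : seq instr) :
  exists K M, [/\ 0 < K, 2 < M & all (instr_bounded K M) P].
Proof.
elim: P => [|i P [K [M [K0 M3 H]]]]; first by exists 1, 3.
pose m := match i with INC r j => r + j | DEC r j k => r + j + k end.
exists (K + m.+1), (M + m.+1); split; [lia|lia|apply/andP; split].
  by rewrite /m; case: i {m} => [r j|r j k] /=; lia.
apply: sub_all H => -[r j|r j k] /=; lia.
Qed.

Section Encoding.
Variables (K M : nat).
Hypothesis M3 : 2 < M.

(** Since [s] is fixed, the classically selected bad patterns can be part of a computable output. *)
Lemma total_rec_foldr k s G : total_rec k G ->
  total_rec k (fun v => foldr code_cons (G v) s).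
Proof.
move=> HG; elim: s => //= x s IH.
by apply: total_rec_cons => //; apply: total_rec_const.
Qed.

Lemma total_rec_pair k F1 F2 (G : seq nat -> seq (nat * nat)) :
  total_rec k F1 -> total_rec k F2 -> total_rec k (fun v => code_pairs (G v)) ->
  total_rec k (fun v => code_pairs ((F1 v, F2 v) :: G v)).
Proof. by move=> H1 H2 HG; do 2 apply: total_rec_cons => //. Qed.

Lemma total_rec_ipath k N : total_rec k N ->
  total_rec k (fun v => code_pairs (ipath_edges K M (N v))).
Proof.
move=> HN; pose f := nfr K M.
pose G j r (_ : seq nat) := code_cons (f + j) (code_cons (f + j.+1)
  (code_cons (3 + pI K * M + j.+1 %% M) (code_cons (f + j.+1) r))).
apply: (@total_rec_ext _ (fun v => iteri (N v) (fun i r => G i r v)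
    (code_pairs (ipath_edges K M 0)))) => [v _|].
  by elim: (N v) => [//|i IH]; rewrite [LHS]/= IH.
have C i : total_rec k.+2 (fun=> i) by apply: total_rec_const.
have V i : i < 2 -> total_rec k.+2 (fun v => nth 0 v i).
  by move=> i2; apply: total_rec_var; lia.
have V1 : total_rec k.+2 (fun v => (nth 0 v 0).+1) by apply/total_rec_succ/V.
apply: total_rec_iteri => //; first exact: total_rec_const.
apply: total_rec_cons; first by apply: total_rec_add => //; apply: V.
apply: total_rec_cons; first by apply: total_rec_add.
apply: total_rec_cons; last by apply: total_rec_cons; [apply: total_rec_add|apply: V].
by apply: total_rec_add => //; apply: total_rec_mod => // v; lia.
Qed.

Lemma total_rec_input_spokes k N : total_rec k N ->
  total_rec k (fun v => code_pairs (input_spokes K M (N v))).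
Proof.
move=> HN; pose f := nfr K M.
pose G j r (_ : seq nat) := code_cons (f + j.+1) (code_cons (pR 0) r).
apply: (@total_rec_ext _ (fun v => iteri (N v) (fun i r => G i r v)
    (code_pairs (input_spokes K M 0)))) => [v _|].
  by elim: (N v) => [//|i IH]; rewrite [LHS]/= IH.
have C i : total_rec k.+2 (fun=> i) by apply: total_rec_const.
have V i : i < 2 -> total_rec k.+2 (fun v => nth 0 v i).
  by move=> i2; apply: total_rec_var; lia.
apply: total_rec_iteri => //; first exact: total_rec_const.
apply: total_rec_cons; last by apply: total_rec_cons => //; apply: V.
by apply: total_rec_add => //; apply/total_rec_succ/V.
Qed.

Lemma total_rec_encode k nv nu (E S R p : seq nat -> seq (nat * nat)) :
  total_rec k nv -> total_rec k nu -> total_rec k (fun v => code_pairs (E v)) ->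
  total_rec k (fun v => code_pairs (S v)) -> total_rec k (fun v => code_pairs (R v)) ->
  total_rec k (fun v => code_pairs (p v)) ->
  total_rec k (fun v => encode_pg (Pathograph (nv v) (nu v) (E v) (S v) (R v) (p v))).
Proof.
by move=> *; do 6 apply: total_rec_cons => //; apply: total_rec_const.
Qed.

Lemma total_rec_input_pg : total_rec 1 (fun v => encode_pg (input_pg K M (nth 0 v 0))).
Proof.
have C i : total_rec 1 (fun=> i) by apply: total_rec_const.
have V : total_rec 1 (fun v => nth 0 v 0) by apply: total_rec_var.
have VM : total_rec 1 (fun v => nth 0 v 0 + M) by apply: total_rec_add.
apply: total_rec_encode => //.
- by apply: total_rec_add => //; apply: total_rec_succ.
- apply: total_rec_pair => //; first exact: total_rec_add.
  apply: total_rec_pair => //; first exact: total_rec_add.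
  exact: total_rec_ipath.
- exact: total_rec_input_spokes.
Qed.

Lemma total_rec_mark_pattern k N : total_rec k N ->
  total_rec k (fun v => encode_pg (mark_pattern K M (N v))).
Proof.
move=> HN; have C i : total_rec k (fun=> i) by apply: total_rec_const.
apply: total_rec_encode => //.
- by apply: total_rec_add => //; apply: total_rec_succ.
- apply: total_rec_pair => //; first exact: total_rec_add.
  exact: total_rec_ipath.
Qed.

Lemma total_rec_forcing_patterns Fs : total_rec 1 (fun v => let n := nth 0 v 0 in
  encode_pgs (Fs ++ nomark_pattern K M n :: mark_patterns K M n)).
Proof.
have V : total_rec 1 (fun v => nth 0 v 0) by apply: total_rec_var.
apply: (@total_rec_ext _ (fun v => foldr code_cons
    (code_cons (encode_pg (nomark_pattern K M (nth 0 v 0)))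
       (encode_pgs (mark_patterns K M (nth 0 v 0)))) (map encode_pg Fs))) => [v _|].
  by rewrite /encode_pgs map_cat /CodeSeq.code foldr_cat.
apply: total_rec_foldr; apply: total_rec_cons.
  apply: total_rec_encode; try exact: total_rec_const.
  - by apply: total_rec_add; [apply: total_rec_const|apply: total_rec_succ].
  - exact: total_rec_ipath.
apply: (@total_rec_ext _ (fun v => iteri (nth 0 v 0)
    (fun i r => code_cons (encode_pg (mark_pattern K M i)) r) 0)) => [v _|].
  by elim: (nth 0 v 0) => [//|i IH]; rewrite [LHS]/= IH.
apply: (total_rec_iteri (G := fun i r _ => code_cons (encode_pg (mark_pattern K M i)) r)) => //.
  exact: total_rec_const.
by apply: total_rec_cons; [apply: total_rec_mark_pattern; apply: total_rec_var|apply: total_rec_var].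
Qed.

End Encoding.

Theorem theorem6 :
  (exists Fs : seq pathograph,
      all pg_wf Fs /\
      undecidable_set (fun c => exists H : pathograph,
                          [/\ pg_wf H, encode_pg H = c & has_free_realization Fs H]))
  /\
  (exists H : pathograph,
      pg_wf H /\
      undecidable_set (fun c => exists Fs : seq pathograph,
                          [/\ all pg_wf Fs, encode_pgs Fs = c & has_free_realization Fs H])).
Proof.
have [P uP] := undecidable_machine.
have [K [M [K0 M3 Pb]]] := bounds_exist P.
split.
  exists (bad_patterns P K M); split; first exact: bad_patterns_wf.
  apply: undecidable_reduction (total_rec_input_pg K M3) _ uP => n.
  have freeP := input_pg_free K0 M3 Pb n; split.
    by move=> [H [_ /encode_pg_inj -> /freeP.1]].
  move=> /freeP.2 hn; exists (input_pg K M n); split=> //; exact: input_pg_wf.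
exists (generic_pg K M); split; first exact: generic_pg_wf.
apply: undecidable_reduction (total_rec_forcing_patterns K M3 (bad_patterns P K M)) _ uP => n.
have freeP := generic_pg_free K0 M3 Pb n; split.
  by move=> [Fs [_ /encode_pgs_inj -> /freeP.1]].
move=> /freeP.2 hn; eexists; split; [|by []|exact: hn].
by rewrite all_cat bad_patterns_wf /= nomark_pattern_wf // mark_patterns_wf.
Qed.
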